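(* Let $r$ be a natural number, $\mathfrak{X}$ a complex manifold, $\pi=(t_1,\dots,t_r)\colon\mathfrak{X}\to\mathbb{C}^r$ a holomorphic submersion, and $\mathfrak{L}\to\mathfrak{X}$ a holomorphic line bundle. Fix a subset $A\subseteq\{1,\dots,r\}$. For any open subset $U\subseteq\mathfrak{X}$ such that $H^{\ge1}(U,\mathcal{O}_{\mathfrak{L}})=\{0\}$, and for any section $s\in\Gamma_{\mathrm{hol}}(U,\mathfrak{L})$, if $s$ vanishes on $U\cap\bigcap_{i\in A}\{t_i=0\}$, then there exist sections $s_i\in\Gamma_{\mathrm{hol}}(U,\mathfrak{L})$, indexed by $i\in A$, such that $s=\sum_{i\in A}t_is_i$.
   Context: $\Gamma_{\mathrm{hol}}(U,\mathfrak{L})$ is the space of holomorphic sections of $\mathfrak{L}$ over $U$, and $\mathcal{O}_{\mathfrak{L}}$ is the sheaf $U\mapsto\Gamma_{\mathrm{hol}}(U,\mathfrak{L})$. Cohomology means Čech cohomology (the direct limit over open coverings), and $H^{\geq1}(U,\mathcal{O}_{\mathfrak{L}})=\{0\}$ means that all cohomology groups in degrees $\geq1$ vanish. When $A=\emptyset$ the intersection $U\cap\bigcap_{i\in A}\{t_i=0\}$ is $U$ and the sum is $0$. *)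

(* Defs.v *)
From HB Require Import structures.
From mathcomp Require Import all_boot all_order all_algebra.
From mathcomp Require Import all_classical all_reals all_analysis.
From mathcomp Require Export complex.

Set Implicit Arguments.
Unset Strict Implicit.
Unset Printing Implicit Defensive.

Import Order.TTheory GRing.Theory Num.Theory.
Import numFieldNormedType.Exports.

Local Open Scope classical_set_scope.
Local Open Scope ring_scope.

(* R[i], packaged as a numClosedFieldType so that the generic topology and
   norm of numFieldNormedType are found on it and on row vectors over it. *)
Definition Cplx (R : realType) : numClosedFieldType := R[i].

(* A homeomorphism from the open set [chart_dom] of X onto an open subset of
   C^n.  The maps are total; their values off [chart_dom] and off
   [chart_map @` chart_dom] are irrelevant. *)
Record chart (R : realType) (n : nat) (X : topologicalType) := Chart {
  chart_dom : set X ;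
  chart_map : X -> 'rV[Cplx R]_n ;
  chart_inv : 'rV[Cplx R]_n -> X ;
  chart_dom_open : open chart_dom ;
  chart_cod_open : open (chart_map @` chart_dom) ;
  chart_mapK : {in chart_dom, cancel chart_map chart_inv} ;
  chart_map_cont : {within chart_dom, continuous chart_map} ;
  chart_inv_cont : {within chart_map @` chart_dom, continuous chart_inv}
}.

(* Holomorphic maps are those that are Frechet differentiable over C at every
   point of an open set.  The transition map is tested on the open set
   [chart_map c @` (chart_dom c `&` chart_dom d)]. *)
Definition charts_compatible R n X (c d : chart R n X) : Prop :=
  forall x, chart_dom c x -> chart_dom d x ->
    differentiable (chart_map d \o chart_inv c) (chart_map c x).

Record complexManifold (R : realType) (n : nat) := ComplexManifold {
  cm_carrier :> topologicalType ;
  cm_hausdorff : hausdorff_space cm_carrier ;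
  cm_second_countable : @second_countable cm_carrier ;
  cm_atlas : set (chart R n cm_carrier) ;
  cm_atlas_cover : forall x, exists2 c, cm_atlas c & chart_dom c x ;
  cm_atlas_compat : forall c d,
    cm_atlas c -> cm_atlas d -> charts_compatible c d
}.

Section Holomorphic.
Variables (R : realType) (n : nat) (X : complexManifold R n).

(* Meant for an open set D. *)
Definition holomorphic_on (W : normedModType (Cplx R)) (D : set X)
    (f : X -> W) : Prop :=
  forall c, cm_atlas c -> forall x, D x -> chart_dom c x ->
    differentiable (f \o chart_inv c) (chart_map c x).

Definition holomorphic_submersion (r : nat) (f : X -> 'rV[Cplx R]_r) : Prop :=
  holomorphic_on setT f /\
  forall c, cm_atlas c -> forall x, chart_dom c x ->
    set_surj setT setT ('d (f \o chart_inv c) (chart_map c x)).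

(* A family of complex vector spaces with local trivializations onto C that are
   linear isomorphisms on fibres and whose transition functions are
   holomorphic; this determines the topology and the complex structure of the
   total space.  Off [lb_dom a], [lb_triv a] is irrelevant. *)
Record lineBundle := LineBundle {
  lb_fibre :> X -> lmodType (Cplx R) ;
  lb_idx : Type ;
  lb_dom : lb_idx -> set X ;
  lb_triv : forall (a : lb_idx) (x : X), {linear lb_fibre x -> (Cplx R)^o} ;
  lb_dom_open : forall a, open (lb_dom a) ;
  lb_dom_cover : forall x, exists a, lb_dom a x ;
  lb_triv_bij : forall a x, lb_dom a x -> bijective (lb_triv a x) ;
  lb_transition : forall a b, exists2 g : X -> (Cplx R)^o,
    holomorphic_on (lb_dom a `&` lb_dom b) g &
    forall x, lb_dom a x -> lb_dom b x ->
      forall v, lb_triv b x v = g x * lb_triv a x v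
}.

Variable L : lineBundle.

Implicit Types (U : set X) (q : nat).

(* A section over an open set U is represented by a section over X, not
   necessarily continuous, of which only the values on U matter. *)
Definition lsection := forall x : X, L x.

Definition holomorphic_section U (s : lsection) : Prop :=
  forall a, holomorphic_on (U `&` lb_dom a) (fun x => lb_triv a x (s x)).

Record openCover U := OpenCover {
  oc_idx : Type ;
  oc_set : oc_idx -> set X ;
  oc_open : forall i, open (oc_set i) ;
  oc_cover : \bigcup_i oc_set i = U
}.

Arguments oc_set {U} o i.

Definition refining U (V W : openCover U) (rho : oc_idx W -> oc_idx V) : Prop :=
  forall j, oc_set W j `<=` oc_set V (rho j).

Definition simplex U (V : openCover U) q := 'I_q.+1 -> oc_idx V.

Definition simplex_set U (V : openCover U) q (i : simplex V q) : set X :=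
  \bigcap_k oc_set V (i k).

Definition precochain U (V : openCover U) q := simplex V q -> lsection.

Definition is_cochain U (V : openCover U) q (c : precochain V q) : Prop :=
  forall i, holomorphic_section (simplex_set i) (c i).

Definition cochain_eq U (V : openCover U) q (c d : precochain V q) : Prop :=
  forall i x, simplex_set i x -> c i x = d i x.

Definition cochain0 U (V : openCover U) q : precochain V q := fun _ _ => 0.

Arguments cochain0 {U} V q i x.

Definition cochainB U (V : openCover U) q (c d : precochain V q) :
    precochain V q :=
  fun i x => c i x - d i x.

Definition cech_diff U (V : openCover U) q (c : precochain V q) :
    precochain V q.+1 :=
  fun i x => \sum_(k < q.+2) (-1) ^+ k *: c (i \o lift k) x.

Definition is_cocycle U (V : openCover U) q (c : precochain V q) : Prop :=
  is_cochain c /\ cochain_eq (cech_diff c) (cochain0 V q.+1).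

Definition is_coboundary U (V : openCover U) q (c : precochain V q.+1) : Prop :=
  exists2 b : precochain V q, is_cochain b & cochain_eq c (cech_diff b).

Definition cochain_pullback U (V W : openCover U)
    (rho : oc_idx W -> oc_idx V) q (c : precochain V q) : precochain W q :=
  fun j => c (rho \o j).

(* Cocycles c on V and d on W represent the same element of the direct limit
   over open coverings of U if they become cohomologous on a common
   refinement. *)
Definition cech_equiv U q (V W : openCover U) (c : precochain V q.+1)
    (d : precochain W q.+1) : Prop :=
  exists (T : openCover U) (rho : oc_idx T -> oc_idx V)
         (sigma : oc_idx T -> oc_idx W),
    [/\ refining rho, refining sigma &
        is_coboundary
          (cochainB (cochain_pullback rho c) (cochain_pullback sigma d))].

(* H^{>= 1}(U, O_L) = {0}: in each degree q+1, every class is the class of the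
   zero cocycle. *)
Definition cech_acyclic U : Prop :=
  forall q (V : openCover U) (c : precochain V q.+1),
    is_cocycle c -> cech_equiv c (cochain0 V q.+1).

End Holomorphic.

Arguments oc_set {R n X U} o i.
Arguments cochain0 {R n X} L {U} V q i x.

(* Main.v *)
Require Import Defs.
From HB Require Import structures.
From mathcomp Require Import all_boot all_order all_algebra.
From mathcomp Require Import all_classical all_reals all_analysis.
From mathcomp Require Import complex ring lra zify.

(* For B a subset of {1, ..., r}, let I_B be the sheaf of sections of L that
   vanish on the common zero set of the t_i, i in B.  For k not in B there is
   an exact sequence

     0 -> I_B -> I_B + O_L -> I_(B + k) -> 0,

   with maps e |-> (- t_k e, e) and (a, b) |-> a + t_k b.  It is exact in the
   middle because {t_k != 0} is dense in the zero set of B, and on the right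
   because a section of I_(B + k) is locally the sum of its composition with a
   retraction onto {t_k = 0} and of a multiple of t_k (Hadamard's lemma).  By
   induction on B all the I_B are acyclic on U, and so the sections of
   I_(B + k) over U are sums a + t_k b with a in I_B(U) and b in O_L(U).

   Retraction and quotient are uniform limits of explicit holomorphic
   functions.  Such limits are holomorphic by the Lipschitz estimate
   |f y - f x| <= 8 M / r |y - x| for f bounded by M near x, which is a
   consequence of Goursat's theorem for squares. *)

Set Implicit Arguments.
Unset Strict Implicit.
Unset Printing Implicit Defensive.
Import Order.TTheory GRing.Theory Num.Theory.
Import numFieldNormedType.Exports.
Local Open Scope classical_set_scope.
Local Open Scope ring_scope.

(** Adding one coordinate at a time keeps the kernel of the exact sequence equal to the single sheaf
    I_B, in place of a whole Koszul complex. Acyclicity, not only generation, has to travel through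
    the induction: lifting a cochain of I_(B + k) leaves an obstruction in I_B one degree higher.
    The induction starts at I_B = 0 for empty B. Two obstacles shape the rest. Local splittings are
    needed on all intersections of one cover at once, which calls for a refinement adapted to
    simplices rather than to points. And holomorphy is mere complex differentiability at every point
    of an open set, so all regularity must be derived. The Lipschitz estimate carries this: being
    linear in the bound M, it applies to differences of approximations (uniform limits), to
    increments of a function (second-order remainders) and to the error of an affine approximation
    (strict differentiability, hence implicit functions). It comes from the sign of one contour
    integral instead of an integral formula, so that only the vanishing of the imaginary part of an
    integral around a fixed square is required. *)

Section Norm.
Variable R : realType.
Local Notation C := (Cplx R).

Definition toC (x : R) : C := real_complex R x.

Lemma toCD x y : toC (x + y) = toC x + toC y. Proof. exact: (rmorphD (real_complex R)). Qed.
Lemma toCM x y : toC (x * y) = toC x * toC y. Proof. exact: (rmorphM (real_complex R)). Qed.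
Lemma toC0 : toC 0 = 0. Proof. by []. Qed.
Lemma toC1 : toC 1 = 1. Proof. by []. Qed.
Lemma toCV x : toC x^-1 = (toC x)^-1. Proof. exact: (fmorphV (real_complex R)). Qed.
Lemma toC_nat n : toC n%:R = n%:R. Proof. exact: (rmorph_nat (real_complex R)). Qed.
Lemma toC_inj : injective toC. Proof. by move=> x y []. Qed.
Lemma toC_le x y : (toC x <= toC y) = (x <= y). Proof. exact: (@lecR R). Qed.
Lemma toC_lt x y : (toC x < toC y) = (x < y). Proof. exact: (@ltcR R). Qed.

Definition ReC (z : C) : R := complex.Re z.
Definition ImC (z : C) : R := complex.Im z.

(** The norm of a normed module over [C] has values in [C], whose order is only partial. Its real
    part loses nothing by [nrmE] and makes real arithmetic available. *)
Definition nrm (V : normedModType C) (v : V) : R := ReC `|v|.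

Lemma toC_ge0 (z : C) : 0 <= z -> z = toC (ReC z).
Proof.
by move=> z0; rewrite /toC /ReC; apply/esym/RRe_real/ger0_real.
Qed.

Lemma nrmE (V : normedModType C) (v : V) : `|v| = toC (nrm v).
Proof. exact/toC_ge0. Qed.

Lemma nrm_ge0 (V : normedModType C) (v : V) : 0 <= nrm v.
Proof. by rewrite -toC_le -nrmE toC0. Qed.

Lemma nrm0 (V : normedModType C) : nrm (0 : V) = 0.
Proof. by apply: toC_inj; rewrite -nrmE normr0. Qed.

Lemma nrm_eq0 (V : normedModType C) (v : V) : nrm v = 0 -> v = 0.
Proof. by move=> v0; apply/normr0_eq0; rewrite nrmE v0. Qed.

Lemma nrm_gt0 (V : normedModType C) (v : V) : v != 0 -> 0 < nrm v.
Proof. by move=> v0; rewrite -toC_lt -nrmE normr_gt0. Qed.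

Lemma nrmN (V : normedModType C) (v : V) : nrm (- v) = nrm v.
Proof. by rewrite /nrm normrN. Qed.

Lemma nrmB (V : normedModType C) (v w : V) : nrm (v - w) = nrm (w - v).
Proof. by rewrite /nrm distrC. Qed.

Lemma nrmD (V : normedModType C) (v w : V) : nrm (v + w) <= nrm v + nrm w.
Proof. by rewrite -toC_le toCD -!nrmE ler_normD. Qed.

Lemma nrmBD (V : normedModType C) (w v u : V) : nrm (v - u) <= nrm (v - w) + nrm (w - u).
Proof. by rewrite -[v - u](subrKA w) nrmD. Qed.

Lemma nrmZ (V : normedModType C) (a : C) (v : V) : nrm (a *: v) = nrm (a : C^o) * nrm v.
Proof. by apply: toC_inj; rewrite toCM -!nrmE normrZ. Qed.

Local Notation cabs := (@nrm C^o).

Lemma cabsM (a b : C) : cabs (a * b) = cabs a * cabs b.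
Proof. by rewrite -[a * b]/(a *: (b : C^o)) nrmZ. Qed.

Lemma cabs_toC x : cabs (toC x) = `|x|.
Proof.
apply: toC_inj; rewrite -nrmE; apply: etrans (normc_def _) _.
by congr (toC _); rewrite /= expr0n addr0 sqrtr_sqr.
Qed.

Lemma cabsV (a : C) : cabs a^-1 = (cabs a)^-1.
Proof. by apply: toC_inj; rewrite -nrmE toCV -nrmE normfV. Qed.

Lemma cabsE (z : C) : cabs z = Num.sqrt (ReC z ^+ 2 + ImC z ^+ 2).
Proof. by apply: toC_inj; rewrite -nrmE; exact: normc_def. Qed.

Lemma sqr_cabs (z : C) : cabs z ^+ 2 = ReC z ^+ 2 + ImC z ^+ 2.
Proof. by rewrite cabsE sqr_sqrtr // addr_ge0 ?sqr_ge0. Qed.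

Lemma ReC_le (z : C) : `|ReC z| <= cabs z.
Proof.
rewrite -(@ler_pXn2r _ 2) ?nnegrE ?nrm_ge0 ?normr_ge0 // real_normK ?num_real //.
by rewrite sqr_cabs lerDl sqr_ge0.
Qed.

Lemma ImC_le (z : C) : `|ImC z| <= cabs z.
Proof.
rewrite -(@ler_pXn2r _ 2) ?nnegrE ?nrm_ge0 ?normr_ge0 // real_normK ?num_real //.
by rewrite sqr_cabs lerDr sqr_ge0.
Qed.

Lemma cabs_le (z : C) : cabs z <= `|ReC z| + `|ImC z|.
Proof.
rewrite -(@ler_pXn2r _ 2) ?nnegrE ?nrm_ge0 ?addr_ge0 ?normr_ge0 //.
rewrite sqr_cabs sqrrD !real_normK ?num_real // -addrA [X in _ <= _ + X]addrC.
by rewrite addrA lerDl mulrn_wge0 // mulr_ge0.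
Qed.

Lemma ReCD (z w : C) : ReC (z + w) = ReC z + ReC w.
Proof. by case: z w => a b [c d]. Qed.
Lemma ImCD (z w : C) : ImC (z + w) = ImC z + ImC w.
Proof. by case: z w => a b [c d]. Qed.
Lemma ReCN (z : C) : ReC (- z) = - ReC z.
Proof. by case: z. Qed.
Lemma ImCN (z : C) : ImC (- z) = - ImC z.
Proof. by case: z. Qed.
Lemma ReCM (z w : C) : ReC (z * w) = ReC z * ReC w - ImC z * ImC w.
Proof. by case: z w => a b [c d]. Qed.
Lemma ImCM (z w : C) : ImC (z * w) = ReC z * ImC w + ImC z * ReC w.
Proof. by case: z w => a b [c d]. Qed.

Definition mkC (x y : R) : C := Complex x y.
Lemma mkCK (z : C) : mkC (ReC z) (ImC z) = z. Proof. by case: z. Qed.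
Lemma nbhs_nrm (V : normedModType C) (x : V) (P : set V) :
  nbhs x P <-> exists2 d : R, 0 < d & forall y, nrm (y - x) < d -> P y.
Proof.
split => [/nbhs_normP [e /= e0 xeP]|[d d0 dP]].
  have eE := @toC_ge0 e (ltW e0).
  exists (ReC e); first by rewrite -toC_lt -eE.
  move=> y yx; apply: xeP; rewrite /ball_ /= distrC nrmE eE toC_lt //.
apply/nbhs_normP; exists (toC d) => /=; first by rewrite -toC0 toC_lt.
by move=> y; rewrite /ball_ /= distrC nrmE toC_lt => /dP.
Qed.

(** * Frechet differentiability with real error bounds *)

Section Diff.
Variables V W : normedModType C.
Implicit Types (f : V -> W) (x : V).

Definition frechet_approx f x (A : V -> W) := forall e : R, 0 < e ->
  exists2 d, 0 < d & forall h, nrm h < d -> nrm (f (x + h) - f x - A h) <= e * nrm h.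

Lemma linear_bound (A : {linear V -> W}) : continuous A ->
  exists2 K, 0 < K & forall h, nrm (A h) <= K * nrm h.
Proof.
move=> /linear_bounded_continuous/linear_boundedP /pinfty_ex_gt0 [k k0 kP].
have kE := @toC_ge0 k (ltW k0).
exists (ReC k); first by rewrite -toC_lt -kE.
by move=> h; rewrite -toC_le toCM -!nrmE -kE.
Qed.

Lemma bound_linear (A : {linear V -> W}) K :
  (forall h, nrm (A h) <= K * nrm h) -> continuous A.
Proof.
move=> AK; apply/linear_bounded_continuous/bounded_funP => r.
exists (toC (`|K| * `|ReC r|)) => x xr.
have rE : r = toC (ReC r) by apply: toC_ge0; apply: le_trans xr.
rewrite nrmE toC_le (le_trans (AK _)) // (@le_trans _ _ (`|K| * nrm x)) //.
  by rewrite ler_wpM2r ?nrm_ge0 // ler_norm.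
rewrite ler_wpM2l // (le_trans _ (ler_norm _)) //.
by rewrite -toC_le -nrmE -rE.
Qed.

Lemma diff_approx f x : differentiable f x -> frechet_approx f x ('d f x).
Proof.
move=> /diff_locallyP [_ /eqaddoP H] e e0.
have {H} /nbhs_nrm [d d0 H] : \forall h \near 0, `|(f \o shift x - (cst (f x) + 'd f x)) h| <= toC e * `|h|.
  by apply: H; rewrite -toC0 toC_lt.
exists d => // h hd; have /= := H h; rewrite subr0 => /(_ hd).
rewrite !nrmE -toCM toC_le; congr (nrm _ <= _).
by rewrite -[LHS]/(f (h + x) - (f x + 'd f x h)) opprD addrA [h + x]addrC.
Qed.

(** The bound [K] stands for the continuity of [A], which is not automatic because [V] may have
    infinite dimension. *)
Lemma approx_diff f x (A : {linear V -> W}) K :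
  (forall h, nrm (A h) <= K * nrm h) -> frechet_approx f x A -> differentiable f x /\ 'd f x = A :> (V
      -> W).
Proof.
move=> /bound_linear cA ap.
have E : f \o shift x = cst (f x) + A +o_ 0 id.
  apply/eqaddoP => e e0; have eE := @toC_ge0 e (ltW e0).
  have [|d d0 dP] := ap (ReC e); first by rewrite -toC_lt -eE.
  apply/nbhs_nrm; exists d => // h; rewrite subr0 => /dP {}dP.
  rewrite eE !nrmE -toCM toC_le; move: dP; congr (nrm _ <= _).
  by rewrite -[RHS]/(f (h + x) - (f x + A h)) opprD addrA [h + x]addrC.
have dA := diff_unique cA E.
by split=> //; apply/diff_locallyP; rewrite dA.
Qed.

End Diff.

End Norm.

(** * Goursat's theorem on squares *)

Section RealAnalysis.
Variable R : realType.

Lemma clamp_in (a b x : R) : a <= b -> a <= Num.max a (Num.min b x) <= b.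
Proof. by move=> ab; rewrite le_max lexx /= ge_max ab ge_min lexx. Qed.

Lemma clamp_id (a b x : R) : a <= x <= b -> Num.max a (Num.min b x) = x.
Proof. by move=> /andP[ax xb]; rewrite (min_r xb) (max_r ax). Qed.

Lemma clamp_lip (a b x y : R) :
  `|Num.max a (Num.min b x) - Num.max a (Num.min b y)| <= `|x - y|.
Proof.
have := ler_norm (x - y); have := ler_norm (- (x - y)); rewrite normrN ler_norml => ? ?.
case: (ltP b x) => ?; case: (ltP b y) => ?; rewrite /Order.max;
  by do ![case: ifPn; rewrite -?leNgt => ?]; lra.
Qed.

(** Clamping the argument to [a, b] extends [u] to a continuous function on the line. Integrating
    from [a - 1] makes both end points interior, so the derivatives there are two-sided. *)
Lemma primitive (u : R -> R) (a b : R) : a <= b ->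
  (forall x, a <= x <= b -> {for x, continuous u}) ->
  exists U : R -> R, forall x, a <= x <= b -> is_derive x 1 U (u x).
Proof.
move=> ab cu.
pose v x := u (Num.max a (Num.min b x)).
have cv : continuous v.
  move=> x; apply/cvgrPdist_lt => e e0.
  have /cvgrPdist_lt /(_ e e0) := cu _ (clamp_in x ab).
  move=> /nbhs_ballP [d /= d0 dP].
  apply/nbhs_ballP; exists d => //= y yx; apply: dP.
  by apply: le_lt_trans yx; exact: clamp_lip.
exists (fun x => \int[lebesgue_measure]_(t in `[(a - 1), x]) v t)%R.
move=> x /andP[ax xb].
have := @continuous_FTC1_closed R v (a - 1) x (b + 1).
case=> //.
- by lra.
- apply: continuous_compact_integrable; first exact: segment_compact.
  exact: continuous_subspaceT.
- by lra.
- exact: cv.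
move=> dF dE; apply: DeriveDef => //.
by rewrite -derive1E dE /v clamp_id // ax.
Qed.

Lemma incr_mean (U u : R -> R) (a b : R) : a <= b ->
  (forall x, a <= x <= b -> is_derive x 1 U (u x)) ->
  exists2 c, a <= c <= b & U b - U a = u c * (b - a).
Proof.
move=> ab dU.
have [x|| c cab ->] := @MVT_segment R U u a b ab.
- by rewrite in_itv /= => /andP[/ltW ax /ltW xb]; apply: dU; rewrite ax.
- apply: derivable_within_continuous => x; rewrite in_itv /= => xab.
  by have [] := dU x xab.
by exists c => //; move: cab; rewrite in_itv.
Qed.

(** Repeated halving, always keeping a quarter on which [J] is positive, gives nested squares. Each
    lower left corner is below every upper right corner, so the suprema of the lower left
    coordinates define a point of all the squares. *)
Lemma bisection (J : R -> R -> R -> R) (x0 y0 s0 : R) : 0 < s0 ->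
  (forall x y s, 0 < s -> 0 < J x y (s + s) ->
     [\/ 0 < J x y s, 0 < J (x + s) y s, 0 < J x (y + s) s | 0 < J (x + s) (y + s) s]) ->
  0 < J x0 y0 s0 ->
  exists px py, [/\ x0 <= px <= x0 + s0, y0 <= py <= y0 + s0 &
    forall d, 0 < d -> exists x y s, [/\ 0 < s < d,
      x <= px <= x + s /\ y <= py <= y + s,
      x0 <= x /\ x + s <= x0 + s0, y0 <= y /\ y + s <= y0 + s0 & 0 < J x y s]].
Proof.
move=> s00 Jsplit J0.
pose Q (p q : R * R * R) := 0 < p.2 -> 0 < J p.1.1 p.1.2 p.2 ->
  [/\ q.2 = p.2 / 2, p.1.1 <= q.1.1 /\ q.1.1 + q.2 <= p.1.1 + p.2,
     p.1.2 <= q.1.2 /\ q.1.2 + q.2 <= p.1.2 + p.2 & 0 < J q.1.1 q.1.2 q.2].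
have /choice[g gP] : forall p, exists q, Q p q.
  move=> [[x y] s]; rewrite /Q /=.
  have [s_gt0|_] := ltP 0 s; last by exists (x, y, s) => //.
  have [Jp|_] := ltP 0 (J x y s); last by exists (x, y, s) => //.
  have h0 : 0 < s / 2 by lra.
  have := @Jsplit x y (s / 2) h0; rewrite -splitr => /(_ Jp) [] JJ.
  - by exists (x, y, s / 2) => _ _; split => //=; lra.
  - by exists (x + s / 2, y, s / 2) => _ _; split => //=; lra.
  - by exists (x, y + s / 2, s / 2) => _ _; split => //=; lra.
  - by exists (x + s / 2, y + s / 2, s / 2) => _ _; split => //=; lra.
pose f n := iter n g (x0, y0, s0).
pose X n := (f n).1.1; pose Y n := (f n).1.2; pose S n := (f n).2.
have pos n : 0 < S n /\ 0 < J (X n) (Y n) (S n).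
  elim: n => [//|n [IH1 IH2]]; have := gP (f n) IH1 IH2.
  rewrite /X /Y /S /f /= => -[-> _ _ ?]; split=> //.
  by rewrite divr_gt0.
have step n : [/\ S n.+1 = S n / 2, X n <= X n.+1 /\ X n.+1 + S n.+1 <= X n + S n
    & Y n <= Y n.+1 /\ Y n.+1 + S n.+1 <= Y n + S n].
  by have [p1 p2] := pos n; have [? ? ? _] := gP (f n) p1 p2.
have mono m n : (m <= n)%N -> [/\ X m <= X n, X n + S n <= X m + S m, Y m <= Y n & Y n + S n <= Y m + S m].
  elim: n => [|n IH]; first by rewrite leqn0 => /eqP ->.
  rewrite leq_eqVlt => /predU1P[->//|/IH [? ? ? ?]].
  by have [_ [? ?] [? ?]] := step n; split; lra.
have below m n : X m <= X n + S n /\ Y m <= Y n + S n.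
  have [pm _] := pos m; have [pn _] := pos n.
  by have [/mono[]|/ltnW/mono[]] := leqP m n => ? ? ? ?; split; lra.
have supP (Z : nat -> R) : (forall m n, Z m <= Z n + S n) -> forall n, Z n <= sup (range Z) <= Z n + S n.
  move=> ZS n; apply/andP; split.
    apply: ub_le_sup; last by exists n.
    by exists (Z 0%N + S 0%N) => _ [m _ <-].
  by apply: ge_sup; [exists (Z 0%N), 0%N | move=> _ [m _ <-]].
have XP := supP X (fun m n => (below m n).1).
have YP := supP Y (fun m n => (below m n).2).
exists (sup (range X)), (sup (range Y)); split.
- exact: (XP 0%N).
- exact: (YP 0%N).
move=> d d0.
have SE n : S n * 2 ^+ n = s0.
  elim: n => [|n IH]; first by rewrite mulr1.
  have [-> _ _] := step n; rewrite exprS -[RHS]IH; by field.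
(* With [n] the integer part of [s0 / d], one has [s0 / d < n + 1 <= 2 ^ n]. *)
have [n nP] : exists n, S n < d.
  pose n := Num.truncn (s0 / d); exists n.
  have lt2 : s0 / d < 2 ^+ n.
    apply: (@lt_le_trans _ _ n.+1%:R).
      by rewrite /n truncnS_gt.
    by rewrite -natrX ler_nat ltn_expl.
  rewrite ltr_pdivrMr // mulrC in lt2.
  rewrite -(@ltr_pM2r _ (2 ^+ n)) ?exprn_gt0 // SE; lra.
have [m1 m2 m3 m4] := mono 0%N n isT.
exists (X n), (Y n), (S n); split => //; last by have [] := pos n.
by have [-> _] := pos n.
Qed.

(** The odd extension of the square root: increasing, but so steep at 0 that an interval of length s
    around 0 has increment at least the square root of s. *)
Definition sroot (x : R) : R := if 0 <= x then Num.sqrt x else - Num.sqrt (- x).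

Lemma sroot_le x y : x <= y -> sroot x <= sroot y.
Proof.
rewrite /sroot => xy; case: ifPn => x0; case: ifPn => y0.
- exact: ler_wsqrtr.
- by lra.
- by rewrite (@le_trans _ _ 0) ?oppr_le0 ?sqrtr_ge0.
- by rewrite lerN2 ler_wsqrtr // lerN2.
Qed.

Lemma sroot_incr x y : x <= 0 <= y -> Num.sqrt (y - x) <= sroot y - sroot x.
Proof.
move=> /andP[x0 y0]; rewrite /sroot y0.
have -> : - (if 0 <= x then Num.sqrt x else - Num.sqrt (- x)) = Num.sqrt (- x).
  case: ifPn => [x0'|_]; last by rewrite opprK.
  have -> : x = 0 by lra.
  by rewrite oppr0 sqrtr0 oppr0.
rewrite -(@ler_pXn2r _ 2) ?nnegrE ?addr_ge0 ?sqrtr_ge0 //.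
rewrite sqrrD !sqr_sqrtr; [|lra..].
have : 0 <= Num.sqrt y * Num.sqrt (- x) by rewrite mulr_ge0 ?sqrtr_ge0.
by rewrite mulr2n => ?; lra.
Qed.

End RealAnalysis.

Section Goursat.
Variable R : realType.
Local Notation C := (Cplx R).
Local Notation cabs := (@nrm R C^o).

Lemma continuous_nrm (V W : normedModType C) (f : V -> W) x :
  {for x, continuous f} <->
  forall e : R, 0 < e -> exists2 d, 0 < d & forall y, nrm (y - x) < d -> nrm (f y - f x) < e.
Proof.
split=> [/cvgrPdist_lt cf e e0|cf].
  have {cf} /nbhs_nrm [d d0 dP] : \forall t \near x, `|f x - f t| < toC e.
    by apply: cf; rewrite -toC0 toC_lt.
  by exists d => // y /dP; rewrite nrmE toC_lt nrmB.
apply/cvgrPdist_lt => e e0; have eE := @toC_ge0 R e (ltW e0).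
have [|d d0 dP] := cf (ReC e); first by rewrite -toC_lt -eE.
by apply/nbhs_nrm; exists d => // y /dP; rewrite eE nrmE toC_lt nrmB.
Qed.

(** Complex linearity of the differential enters here: it is multiplication by one number [a], its
    value at 1, which contains the Cauchy-Riemann equations. *)
Lemma diff_cplx (f : C^o -> C^o) (z : C^o) : differentiable f z ->
  exists a : C, forall e : R, 0 < e -> exists2 d, 0 < d &
    forall w, cabs (w - z) < d -> cabs (f w - f z - a * (w - z)) <= e * cabs (w - z).
Proof.
move=> /diff_approx df; exists ('d f z 1) => e /df [d d0 dP].
exists d => // w /dP; rewrite [z + _]addrC subrK.
have -> : 'd f z (w - z) = 'd f z 1 * (w - z); last by [].
by rewrite -{1}[w - z]mulr1 -[_ * 1]/((w - z) *: (1 : C^o)) linearZ mulrC.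
Qed.

Definition unit_square (z : C) := (-1 <= ReC z <= 1) && (-1 <= ImC z <= 1).

(** The imaginary part of the integral of [psi dz] around the square with lower left corner [(x, y)]
    and side [s], counterclockwise: [U y] is a primitive of Im psi on the horizontal line at height
    [y], and [V x] one of Re psi on the vertical line at [x]. *)
Definition edge_sum (U V : R -> R -> R) (x y s : R) :=
  U y (x + s) - U y x - (U (y + s) (x + s) - U (y + s) x)
  + (V (x + s) (y + s) - V (x + s) y) - (V x (y + s) - V x y).

(* A product of increments of the signed square root: it is additive like the
   area, but a square of side s containing p has weight at least s, which
   absorbs the point p where psi is only continuous. *)
Definition weight (p : C) (x y s : R) :=
  (sroot (x + s - ReC p) - sroot (x - ReC p)) * (sroot (y + s - ImC p) - sroot (y - ImC p)).

Lemma weight_ge0 p x y s : 0 <= s -> 0 <= weight p x y s.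
Proof. by move=> s0; rewrite mulr_ge0 // subr_ge0 sroot_le //; lra. Qed.

Lemma weight_le p x y s : x <= ReC p <= x + s -> y <= ImC p <= y + s -> s <= weight p x y s.
Proof.
move=> xp yp; rewrite -{1}[s]sqr_sqrtr; last by lra.
rewrite expr2 ler_pM ?sqrtr_ge0 //.
- by apply: le_trans (sroot_incr _); [rewrite ler_wsqrtr //; lra | lra].
- by apply: le_trans (sroot_incr _); [rewrite ler_wsqrtr //; lra | lra].
Qed.

Section Local.
Variables (psi : C^o -> C^o) (U V : R -> R -> R).
Hypothesis dU : forall y : R, -1 <= y <= 1 -> forall x : R, -1 <= x <= 1 ->
  is_derive x 1 (U y) (ImC (psi (mkC x y))).
Hypothesis dV : forall x : R, -1 <= x <= 1 -> forall y : R, -1 <= y <= 1 ->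
  is_derive y 1 (V x) (ReC (psi (mkC x y))).

(* Applying the mean value theorem to the difference of the primitives on two
   opposite sides keeps the two evaluation points on a common line. *)
Lemma edge_sum_mean x y s : 0 <= s -> -1 <= x -> x + s <= 1 -> -1 <= y -> y + s <= 1 ->
  exists xi eta, [/\ x <= xi <= x + s, y <= eta <= y + s &
    edge_sum U V x y s =
      (ImC (psi (mkC xi y)) - ImC (psi (mkC xi (y + s)))) * s
      + (ReC (psi (mkC (x + s) eta)) - ReC (psi (mkC x eta))) * s].
Proof.
move=> s0 x0 x1 y0 y1.
have xs : x <= x + s by lra.
have ys : y <= y + s by lra.
have [t /andP[t0 t1]|xi xiP EU] := @incr_mean R (fun t => U y t - U (y + s) t)
   (fun t => ImC (psi (mkC t y)) - ImC (psi (mkC t (y + s)))) x (x + s) xs _.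
  by apply: is_deriveB; apply: dU; lra.
have [t /andP[t0 t1]|eta etaP EV] := @incr_mean R (fun t => V (x + s) t - V x t)
   (fun t => ReC (psi (mkC (x + s) t)) - ReC (psi (mkC x t))) y (y + s) ys _.
  by apply: is_deriveB; apply: dV; lra.
exists xi, eta; split => //.
have sE : x + s - x = s by ring.
have sE' : y + s - y = s by ring.
by rewrite sE in EU; rewrite sE' in EV; rewrite -EU -EV /edge_sum; ring.
Qed.

Hypothesis cpsi : forall z : C^o, unit_square z -> {for z, continuous psi}.

Lemma unit_squareP x y : -1 <= x <= 1 -> -1 <= y <= 1 -> unit_square (mkC x y).
Proof. by move=> x1 y1; rewrite /unit_square x1 y1. Qed.

Lemma cabs_mkC_le x y x' y' s : `|x - x'| <= s -> `|y - y'| <= s ->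
  cabs (mkC x y - mkC x' y') <= 2 * s.
Proof. by move=> xs ys; apply: le_trans (cabs_le _) _; rewrite /=; lra. Qed.

(** On a small square each of the four values of [psi] is within [e / 4] of [psi p], and the
    constant [psi p] cancels between opposite sides. Continuity thus yields order [s] only. *)
Lemma edge_sum_exceptional px py e : -1 <= px <= 1 -> -1 <= py <= 1 -> 0 < e ->
  exists2 d, 0 < d & forall x y s, 0 < s < d -> x <= px <= x + s -> y <= py <= y + s ->
   -1 <= x -> x + s <= 1 -> -1 <= y -> y + s <= 1 -> `|edge_sum U V x y s| <= e * s.
Proof.
move=> px1 py1 e0; set p : C^o := mkC px py.
have /continuous_nrm cp := cpsi (unit_squareP px1 py1).
have [|d d0 dP] := cp (e / 4); first by lra.
exists (d / 2); first by lra.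
move=> x y s /andP[s0 sd] xp yp x0 x1 y0 y1.
have near a b : x <= a <= x + s -> y <= b <= y + s -> cabs (psi (mkC a b) - psi p) <= e / 4.
  move=> aP bP; apply/ltW/dP; apply: le_lt_trans (_ : 2 * s < d); last by lra.
  by apply: cabs_mkC_le; rewrite ler_norml; lra.
have nearR a b : x <= a <= x + s -> y <= b <= y + s -> `|ReC (psi (mkC a b)) - ReC (psi p)| <= e / 4.
  by move=> aP bP; apply: le_trans (near a b aP bP); rewrite -ReCN -ReCD ReC_le.
have nearI a b : x <= a <= x + s -> y <= b <= y + s -> `|ImC (psi (mkC a b)) - ImC (psi p)| <= e / 4.
  by move=> aP bP; apply: le_trans (near a b aP bP); rewrite -ImCN -ImCD ImC_le.
have [|xi [eta [xiP etaP ->]]] := edge_sum_mean _ x0 x1 y0 y1; first exact: ltW.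
rewrite -mulrDl normrM (gtr0_norm s0) ler_pM2r //.
have h1 : x <= x + s <= x + s by lra.
have h2 : x <= x <= x + s by lra.
have h3 : y <= y + s <= y + s by lra.
have h4 : y <= y <= y + s by lra.
have := nearI _ _ xiP h3; have := nearI _ _ xiP h4.
have := nearR _ _ h1 etaP; have := nearR _ _ h2 etaP.
by rewrite !ler_norml; lra.
Qed.

(** The affine approximation contributes nothing: on opposite sides the evaluation points lie on a
    common line, and the two differences give [- Re al * s] and [Re al * s]. Four errors of size
    [e / 8] times the diameter bound [2 * s] remain. *)
Lemma edge_sum_regular px py e : -1 <= px <= 1 -> -1 <= py <= 1 -> 0 < e ->
  differentiable psi (mkC px py : C^o) ->
  exists2 d, 0 < d & forall x y s, 0 < s < d -> x <= px <= x + s -> y <= py <= y + s ->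
   -1 <= x -> x + s <= 1 -> -1 <= y -> y + s <= 1 -> `|edge_sum U V x y s| <= e * (s * s).
Proof.
move=> px1 py1 e0 /diff_cplx; set p : C^o := mkC px py => -[al alP].
have [|d d0 dP] := alP (e / 8); first by lra.
exists (d / 2); first by lra.
move=> x y s /andP[s0 sd] xp yp x0 x1 y0 y1.
have near a b : x <= a <= x + s -> y <= b <= y + s ->
    cabs (psi (mkC a b) - psi p - al * (mkC a b - p)) <= e / 4 * s.
  move=> aP bP; have le2 : cabs (mkC a b - p) <= 2 * s.
    by apply: cabs_mkC_le; rewrite ler_norml; lra.
  apply: le_trans (dP _ _) _; first by lra.
  have -> : e / 4 * s = e / 8 * (2 * s) by field.
  by rewrite ler_pM2l //; lra.
have nearR a b : x <= a <= x + s -> y <= b <= y + s ->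
   `|ReC (psi (mkC a b)) - ReC (psi p) - (ReC al * (a - px) - ImC al * (b - py))| <= e / 4 * s.
  move=> aP bP; apply: le_trans (near a b aP bP).
  by rewrite -[X in ReC al * X]/(ReC (mkC a b - p)) -[X in ImC al * X]/(ImC (mkC a b - p))
    -ReCM -!ReCN -!ReCD ReC_le.
have nearI a b : x <= a <= x + s -> y <= b <= y + s ->
   `|ImC (psi (mkC a b)) - ImC (psi p) - (ReC al * (b - py) + ImC al * (a - px))| <= e / 4 * s.
  move=> aP bP; apply: le_trans (near a b aP bP).
  by rewrite -[X in ImC al * X]/(ReC (mkC a b - p)) -[X in ReC al * X]/(ImC (mkC a b - p))
    -ImCM -!ImCN -!ImCD ImC_le.
have [|xi [eta [xiP etaP ->]]] := edge_sum_mean _ x0 x1 y0 y1; first exact: ltW.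
rewrite -mulrDl normrM (gtr0_norm s0) mulrA ler_pM2r //.
have h1 : x <= x + s <= x + s by lra.
have h2 : x <= x <= x + s by lra.
have h3 : y <= y + s <= y + s by lra.
have h4 : y <= y <= y + s by lra.
have := nearI _ _ xiP h3; have := nearI _ _ xiP h4.
have := nearR _ _ h1 etaP; have := nearR _ _ h2 etaP.
rewrite !ler_norml.
set A1 := ReC (psi _); set A2 := ReC (psi _); set A3 := ReC (psi _).
set B1 := ImC (psi _); set B2 := ImC (psi _); set B3 := ImC (psi _).
by nra.
Qed.

End Local.

(** Two exceptional points are allowed because the lemma will be applied to an iterated difference
    quotient, for which only continuity is available at its two base points. *)
Lemma goursat (psi : C^o -> C^o) (p1 p2 : C) :
  (forall z : C^o, unit_square z -> {for z, continuous psi}) ->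
  (forall z : C^o, unit_square z -> z != p1 -> z != p2 -> differentiable psi z) ->
  exists U V : R -> R -> R, [/\
    forall y : R, -1 <= y <= 1 -> forall x : R, -1 <= x <= 1 ->
      is_derive x 1 (U y) (ImC (psi (mkC x y))),
    forall x : R, -1 <= x <= 1 -> forall y : R, -1 <= y <= 1 ->
      is_derive y 1 (V x) (ReC (psi (mkC x y))) &
    edge_sum U V (-1) (-1) 2 = 0].
Proof.
move=> cpsi dpsi.
have contE (g : R -> C^o) (f : C^o -> R) (t : R) : (forall s, cabs (g s - g t) <= `|s - t|) ->
   (forall z w, `|f z - f w| <= cabs (z - w)) -> unit_square (g t) -> {for t, continuous (f \o psi \o g)}.
  move=> gl fl gt; apply/cvgrPdist_lt => e e0.
  have /continuous_nrm /(_ e e0) [d d0 dP] := cpsi _ gt.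
  apply/nbhs_ballP; exists d => // s; rewrite /ball /= distrC => st.
  rewrite distrC; apply: le_lt_trans (fl _ _) _; apply: dP.
  exact: le_lt_trans (gl _) _.
have lR (z w : C^o) : `|ReC z - ReC w| <= cabs (z - w) by rewrite -ReCN -ReCD ReC_le.
have lI (z w : C^o) : `|ImC z - ImC w| <= cabs (z - w) by rewrite -ImCN -ImCD ImC_le.
have lx (y s t : R) : cabs (mkC s y - mkC t y) <= `|s - t|.
  by apply: le_trans (cabs_le _) _; rewrite /= subrr normr0 addr0.
have ly (x s t : R) : cabs (mkC x s - mkC x t) <= `|s - t|.
  by apply: le_trans (cabs_le _) _; rewrite /= subrr normr0 add0r.
have n11 : (-1 : R) <= 1 by lra.
have /choice[U dU] : forall y : R, exists u : R -> R, -1 <= y <= 1 -> forall x : R, -1 <= x <= 1 ->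
    is_derive x 1 u (ImC (psi (mkC x y))).
  move=> y; have [y1|_] := boolP (-1 <= y <= 1); last by exists id.
  have [x x1|u uP] := @primitive R (fun x => ImC (psi (mkC x y))) _ _ n11; last by exists u.
  by apply: (contE (fun x => mkC x y : C^o) (@ImC R)) => //; apply: unit_squareP.
have /choice[V dV] : forall x : R, exists v : R -> R, -1 <= x <= 1 -> forall y : R, -1 <= y <= 1 ->
    is_derive y 1 v (ReC (psi (mkC x y))).
  move=> x; have [x1|_] := boolP (-1 <= x <= 1); last by exists id.
  have [y y1|v vP] := @primitive R (fun y => ReC (psi (mkC x y))) _ _ n11; last by exists v.
  by apply: (contE (fun y => mkC x y : C^o) (@ReC R)) => //; apply: unit_squareP.
exists U, V; split => //; apply/eqP; apply: contrapT => /negP I0.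
(* Both [edge_sum] and [a] are additive under cutting a square into quarters, so [J] is positive on
   some quarter of any square where it is positive. The factor 2 in [e] leaves [J] half of the edge
   sum on the full square. *)
pose a x y s := s * s + weight p1 x y s + weight p2 x y s.
have a0 : 0 < a (-1) (-1) 2.
  have w1 := @weight_ge0 p1 (-1) (-1) 2; have w2 := @weight_ge0 p2 (-1) (-1) 2.
  by rewrite /a; lra.
pose e := `|edge_sum U V (-1) (-1) 2| / (2 * a (-1) (-1) 2).
have e0 : 0 < e by rewrite divr_gt0 ?normr_gt0 //; lra.
pose J x y s := `|edge_sum U V x y s| - e * a x y s.
have J0 : 0 < J (-1) (-1) 2.
  rewrite /J /e; have n0 : 0 < `|edge_sum U V (-1) (-1) 2| by rewrite normr_gt0.
  have -> : `|edge_sum U V (-1) (-1) 2| / (2 * a (-1) (-1) 2) * a (-1) (-1) 2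
     = `|edge_sum U V (-1) (-1) 2| / 2 by field; rewrite gt_eqF.
  lra.
have Jsplit x y s : 0 < s -> 0 < J x y (s + s) ->
     [\/ 0 < J x y s, 0 < J (x + s) y s, 0 < J x (y + s) s | 0 < J (x + s) (y + s) s].
  move=> s0 JJ.
  have [j1|j1] := ltP 0 (J x y s); first exact: Or41.
  have [j2|j2] := ltP 0 (J (x + s) y s); first exact: Or42.
  have [j3|j3] := ltP 0 (J x (y + s) s); first exact: Or43.
  have [j4|j4] := ltP 0 (J (x + s) (y + s) s); first exact: Or44.
  exfalso; move: JJ; apply/negP; rewrite -leNgt.
  have IE : edge_sum U V x y (s + s) = edge_sum U V x y s + edge_sum U V (x + s) y s
     + edge_sum U V x (y + s) s + edge_sum U V (x + s) (y + s) s.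
    by rewrite /edge_sum !addrA; ring.
  have wE p : weight p x y (s + s) = weight p x y s + weight p (x + s) y s
     + weight p x (y + s) s + weight p (x + s) (y + s) s.
    by rewrite /weight !addrA; ring.
  have aE : a x y (s + s) = a x y s + a (x + s) y s + a x (y + s) s + a (x + s) (y + s) s.
    by rewrite /a !wE; ring.
  move: j1 j2 j3 j4; rewrite /J aE IE => j1 j2 j3 j4.
  have := ler_normD (edge_sum U V x y s + edge_sum U V (x + s) y s
     + edge_sum U V x (y + s) s) (edge_sum U V (x + s) (y + s) s).
  have := ler_normD (edge_sum U V x y s + edge_sum U V (x + s) y s) (edge_sum U V x (y + s) s).
  have := ler_normD (edge_sum U V x y s) (edge_sum U V (x + s) y s).
  lra.
have two0 : (0 : R) < 2 by [].
have [px [py []]] := bisection two0 Jsplit J0.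
have -> : -1 + 2 = 1 :> R by ring.
move=> px1 py1 small.
(* Near a regular point the area term of [a] dominates the edge sum; near an exceptional one the
   weight of that point, at least [s], does. Either way [J] cannot be positive. *)
have [/andP[q1 q2]|exc] := boolP ((mkC px py != p1) && (mkC px py != p2)).
  have [|d d0 dP] := edge_sum_regular dU dV px1 py1 e0.
    by apply: dpsi => //; apply: unit_squareP.
  have [x [y [s [sd [xp yp] [x0 x1] [y0 y1]]]]] := small d d0.
  rewrite /J; apply/negP; rewrite -leNgt subr_le0.
  apply: le_trans (dP _ _ _ sd xp yp x0 x1 y0 y1) _.
  have s0 : 0 <= s by case/andP: sd => /ltW.
  by rewrite ler_pM2l // /a -addrA lerDl addr_ge0 ?weight_ge0.
have [d d0 dP] := edge_sum_exceptional dU dV cpsi px1 py1 e0.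
have [x [y [s [sd [xp yp] [x0 x1] [y0 y1]]]]] := small d d0.
rewrite /J; apply/negP; rewrite -leNgt subr_le0.
apply: le_trans (dP _ _ _ sd xp yp x0 x1 y0 y1) _.
have s0 : 0 <= s by case/andP: sd => /ltW.
rewrite ler_pM2l // /a; have w1 := weight_ge0 p1 x y s0; have w2 := weight_ge0 p2 x y s0.
have ss : 0 <= s * s by rewrite mulr_ge0.
move: exc; rewrite negb_and !negbK => /orP[] /eqP pE.
  by have := @weight_le p1 x y s; rewrite -pE /= => /(_ xp yp); lra.
by have := @weight_le p2 x y s; rewrite -pE /= => /(_ xp yp); lra.
Qed.

End Goursat.

(** * The Lipschitz estimate and uniform limits *)

Section Cauchy.
Variable R : realType.
Local Notation C := (Cplx R).
Local Notation cabs := (@nrm R C^o).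

Lemma differentiable_near_eq (V W : normedModType C) (f g : V -> W) x :
  (\forall y \near x, f y = g y) -> differentiable f x -> differentiable g x.
Proof.
move=> /nbhs_nrm [r r0 rP] df.
have [K K0 KP] := linear_bound (diff_continuous df).
apply: (approx_diff KP _).1 => e e0.
have [d d0 dP] := diff_approx df e0.
exists (Num.min r d); first by rewrite lt_min r0.
move=> h; rewrite lt_min => /andP[hr hd].
rewrite -!rP; first exact: dP.
- by rewrite subrr nrm0.
- by rewrite addrAC subrr add0r.
Qed.

(* The value at z = a, where the quotient is junk, is prescribed. *)
Definition slope (f : C^o -> C^o) (a al z : C^o) : C^o :=
  if z == a then al else (f z - f a) / (z - a).

Lemma slope_differentiable (f : C^o -> C^o) (a al z : C^o) : z != a ->
  differentiable f z -> differentiable (slope f a al) z.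
Proof.
move=> za df.
have : differentiable (fun w : C^o => (f w - f a) * (w - a)^-1 : C^o) z.
  apply: differentiableM; first exact: differentiableB.
  by apply: differentiableV; [exact: differentiableB | rewrite subr_eq0].
apply: differentiable_near_eq; apply/nbhs_nrm; exists (cabs (z - a)).
  by rewrite nrm_gt0 // subr_eq0.
move=> y yz; rewrite /slope; case: eqP => // ya.
by move: yz; rewrite ya nrmB ltxx.
Qed.

Lemma slope_continuous (f : C^o -> C^o) (a : C^o) : differentiable f a ->
  exists al, {for a, continuous (slope f a al)}.
Proof.
move=> /diff_cplx [al alP]; exists al; apply/continuous_nrm => e e0.
have [|d d0 dP] := alP (e / 2); first lra.
exists d => // y ya; rewrite /slope eqxx; case: eqP => [|/eqP nya].
  by rewrite subrr nrm0.
have n0 : y - a != 0 by rewrite subr_eq0.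
have p0 : 0 < cabs (y - a) by rewrite nrm_gt0.
have -> : (f y - f a) / (y - a) - al = (f y - f a - al * (y - a)) / (y - a) by field.
rewrite cabsM cabsV ltr_pdivrMr //; apply: le_lt_trans (dP y ya) _.
by rewrite ltr_pM2r //; lra.
Qed.

Lemma cts_mulC (T : topologicalType) (f g : T -> C^o) (x : T) :
  {for x, continuous f} -> {for x, continuous g} ->
  {for x, continuous (fun y => f y * g y : C^o)}.
Proof. exact: (@continuousM C T). Qed.

Lemma slope_continuous_ne (f : C^o -> C^o) (a al z : C^o) : z != a ->
  {for z, continuous f} -> {for z, continuous (slope f a al)}.
Proof.
move=> za cf.
have : {for z, continuous (fun w : C^o => (f w - f a) * (w - a)^-1 : C^o)}.
  apply: cts_mulC.
    apply: (@continuousB C C^o C^o f (fun=> f a)); [exact: cf | exact: (@cst_continuous _ _ (f a))].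
  apply: differentiable_continuous.
  by apply: differentiableV; [exact: differentiableB | rewrite subr_eq0].
move=> /continuous_nrm cc; apply/continuous_nrm => e /cc [d dd dP].
exists (Num.min d (cabs (z - a))); first by rewrite lt_min dd nrm_gt0 // subr_eq0.
move=> y; rewrite lt_min => /andP[yd yz].
have ya : y != a by apply: contraTneq yz => ->; rewrite nrmB ltxx.
by rewrite /slope (negbTE ya) (negbTE za); apply: dP.
Qed.

(** Multiplication by the conjugate of [1 + i t] gives [Re w * (1 + t^2) = Re k + t * Im k - A],
    which is at most [2 * K - A]. The points [1 + i t] form the right side of the unit square; the
    other sides are rotations of it. *)
Lemma side_sign (w k : C) (K A t : R) : cabs k <= K -> 2 * K < A -> -1 <= t <= 1 ->
  w * mkC 1 t = k - toC A -> ReC w < 0.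
Proof.
move=> kK KA t1 E.
have E1 : ReC w - ImC w * t = ReC k - A.
  by rewrite -[ReC k - A]/(ReC k + ReC (- toC A)) -ReCD -E ReCM /= mulr1.
have E2 : ReC w * t + ImC w = ImC k.
  have -> : ImC k = ImC k + ImC (- toC A) by rewrite /= oppr0 addr0.
  by rewrite -ImCD -E ImCM /= mulr1.
have := le_trans (ReC_le k) kK; have := le_trans (ImC_le k) kK.
rewrite !ler_norml => /andP[i1 i2] /andP[r1 r2].
have E3 : ReC w * (1 + t ^+ 2) = ReC k + t * ImC k - A.
  have -> : ReC w * (1 + t ^+ 2) = (ReC w - ImC w * t) + t * (ReC w * t + ImC w) by ring.
  by rewrite E1 E2; ring.
have le1 : t * ImC k <= K.
  apply: le_trans (ler_norm _) _; rewrite normrM -[K]mul1r ler_pM //.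
  - by rewrite ler_norml; lra.
  - by rewrite ler_norml i1.
rewrite ltNge; apply/negP => w0.
have : 0 <= ReC w * (1 + t ^+ 2) by rewrite mulr_ge0 // addr_ge0 // sqr_ge0.
rewrite E3; lra.
Qed.

(* Let q = slope h mu, k = conj (q 0) * q and psi = slope k 0.  If the bound
   failed, then Im (psi dz) would have a constant sign along the four sides of
   the unit square, contradicting Goursat's theorem. *)
Lemma lipschitz_at_origin (h : C^o -> C^o) (M : R) (mu : C^o) :
  (forall z : C^o, cabs z <= 2 -> differentiable h z) ->
  (forall z : C^o, cabs z <= 2 -> cabs (h z) <= M) ->
  cabs mu <= 1 / 2 -> cabs (h mu - h 0) <= 8 * M * cabs mu.
Proof.
move=> dh hM mu1.
have [->|mu0] := eqVneq mu 0; first by rewrite subrr nrm0 mulr0.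
have pmu : 0 < cabs mu by rewrite nrm_gt0.
have M0 : 0 <= M.
  by apply: le_trans (nrm_ge0 (h 0)) (hM 0 _); rewrite nrm0.
have sq2 z : unit_square z -> cabs z <= 2.
  move=> /andP[z1 z2]; apply: le_trans (cabs_le _) _.
  have : `|ReC z| <= 1 by rewrite ler_norml.
  have : `|ImC z| <= 1 by rewrite ler_norml.
  lra.
have [al alP] := slope_continuous (dh mu (le_trans mu1 (ltac:(lra) : (1 / 2 <= 2 :> R)))).
set q := slope h mu al in alP.
have q0 : q 0 = (h mu - h 0) / mu.
  by rewrite /q /slope eq_sym (negbTE mu0) sub0r -[h 0 - h mu]opprB invrN mulrNN.
have [//|lt8] := leP (cabs (h mu - h 0)) (8 * M * cabs mu).
have {}lt8 : 8 * M < cabs (q 0) by rewrite q0 cabsM cabsV ltr_pdivlMr.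
(* This factor makes [k 0] the positive real number [|q 0|^2]. *)
pose kap : C := mkC (ReC (q 0)) (- ImC (q 0)).
have kapE : cabs kap = cabs (q 0) by rewrite !cabsE /= sqrrN.
pose k (z : C^o) : C^o := kap * q z.
have k0 : k 0 = toC (cabs (q 0) ^+ 2).
  rewrite /k /kap -[q 0 in X in X = _]mkCK sqr_cabs.
  rewrite -[LHS]mkCK ReCM ImCM /=; congr mkC; ring.
have dq z : cabs z <= 2 -> z != mu -> differentiable q z.
  by move=> z2 zmu; exact: (slope_differentiable _ zmu (dh z z2)).
have dk z : cabs z <= 2 -> z != mu -> differentiable k z.
  by move=> z2 zmu; apply: differentiableM; [exact: differentiable_cst | exact: dq].
have ck z : cabs z <= 2 -> {for z, continuous k}.
  move=> z2; have [->|zmu] := eqVneq z mu.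
    exact: (cts_mulC (@cst_continuous _ _ kap _) alP).
  exact: differentiable_continuous (dk _ z2 zmu).
have d0 : differentiable k 0 by apply: dk; rewrite ?nrm0 // eq_sym.
have [be beP] := slope_continuous d0.
set psi := slope k 0 be in beP.
have dpsi z : cabs z <= 2 -> z != 0 -> z != mu -> differentiable psi z.
  by move=> z2 z0 zmu; exact: (slope_differentiable _ z0 (dk z z2 zmu)).
have cpsi (z : C^o) : cabs z <= 2 -> {for z, continuous psi}.
  move=> z2; have [->//|z0] := eqVneq z 0.
  have [zE|zmu] := eqVneq z mu; last exact: differentiable_continuous (dpsi _ z2 z0 zmu).
  exact: (@slope_continuous_ne k 0 be z z0 (ck z z2)).
have [U [V [dU dV]]] := @goursat R psi 0 mu (fun z z1 => cpsi z (sq2 z z1))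
  (fun z z1 => dpsi z (sq2 z z1)).
(* On the boundary of the square [|z - mu| >= 1/2], so [|q z| <= 2 M / (1/2)]. The constant 8 of the
   statement is twice this 4, as [side_sign] demands. *)
have kb z : cabs z <= 2 -> 1 <= cabs z -> cabs (k z) <= 4 * M * cabs (q 0).
  move=> z2 z1; rewrite /k cabsM kapE mulrC ler_pM2r; last first.
    by apply: le_lt_trans lt8; rewrite mulr_ge0.
  have zmu : z != mu by apply: contraTneq z1 => ->; rewrite -ltNge; lra.
  have lb : 1 / 2 <= cabs (z - mu).
    have := nrmD (z - mu : C^o) mu; rewrite subrK; lra.
  have ub : cabs (h z - h mu) <= 2 * M.
    have := nrmD (h z : C^o) (- h mu); rewrite nrmN.
    have := hM z z2; have := hM mu (le_trans mu1 (ltac:(lra) : (1 / 2 <= 2 :> R))); lra.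
  rewrite /q /slope (negbTE zmu) cabsM cabsV ler_pdivrMr; last by lra.
  by apply: le_trans ub _; nra.
pose A := cabs (q 0) ^+ 2.
have KA : 2 * (4 * M * cabs (q 0)) < A.
  have p0 : 0 < cabs (q 0) by apply: le_lt_trans lt8; rewrite mulr_ge0.
  by rewrite /A expr2 mulrA ltr_pM2r //; lra.
(* Here [nn] is the outer normal of the side, so [(nn * psi z) * (1 + i t) = z * psi z = k z - k
   0]. *)
have side (nn z : C) t : -1 <= t <= 1 -> z = nn * mkC 1 t -> unit_square z -> 1 <= cabs z -> ReC (nn *
    psi z) < 0.
  move=> t1 zE zs z1; have z2 := sq2 z zs.
  apply: (side_sign (kb z z2 z1) KA t1).
  have z0 : z != 0 by apply: contraTneq z1 => ->; rewrite nrm0; lra.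
  rewrite mulrAC -zE /psi /slope (negbTE z0) subr0 k0 mulrC divfK //.
have n11 : (-1 : R) <= 1 by lra.
have m1 : -1 <= (-1 : R) <= 1 by lra.
have p1 : -1 <= (1 : R) <= 1 by lra.
have leR z : `|ReC z| = 1 -> 1 <= cabs z by move=> <-; exact: ReC_le.
have leI z : `|ImC z| = 1 -> 1 <= cabs z by move=> <-; exact: ImC_le.
have [a a1 Ua] := incr_mean n11 (dU _ m1).
have [b b1 Ub] := incr_mean n11 (dU _ p1).
have [c c1 Vc] := incr_mean n11 (dV _ m1).
have [d d1 Vd] := incr_mean n11 (dV _ p1).
have sa : ImC (psi (mkC a (-1))) < 0.
  have := @side (mkC 0 (-1)) (mkC a (-1)) a a1 _ _ _; rewrite ReCM /= mul0r sub0r mulN1r opprK; apply.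
  - by rewrite -[RHS]mkCK ReCM ImCM /=; congr mkC; ring.
  - exact: unit_squareP.
  - by apply: leI; rewrite /= normrN1.
have sb : 0 < ImC (psi (mkC b 1)).
  have := @side (mkC 0 1) (mkC b 1) (- b) _ _ _ _; rewrite ReCM /= mul0r sub0r mul1r oppr_lt0; apply.
  - by lra.
  - by rewrite -[RHS]mkCK ReCM ImCM /=; congr mkC; ring.
  - exact: unit_squareP.
  - by apply: leI; rewrite /= normr1.
have sc : 0 < ReC (psi (mkC (-1) c)).
  have := @side (mkC (-1) 0) (mkC (-1) c) (- c) _ _ _ _; rewrite ReCM /= mul0r subr0 mulN1r oppr_lt0; apply.
  - by lra.
  - by rewrite -[RHS]mkCK ReCM ImCM /=; congr mkC; ring.
  - exact: unit_squareP.
  - by apply: leR; rewrite /= normrN1.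
have sd : ReC (psi (mkC 1 d)) < 0.
  have := @side (mkC 1 0) (mkC 1 d) d d1 _ _ _; rewrite ReCM /= mul0r subr0 mul1r; apply.
  - by rewrite -[RHS]mkCK ReCM ImCM /=; congr mkC; ring.
  - exact: unit_squareP.
  - by apply: leR; rewrite /= normr1.
(* By the mean value theorem each of the four sides contributes a negative number, so the sum cannot
   be 0. *)
rewrite /edge_sum; have -> : -1 + 2 = 1 :> R by ring.
rewrite Ua Ub Vc Vd => E; exfalso; lra.
Qed.

End Cauchy.

Lemma diffB_at (K : numFieldType) (V W : normedModType K) (f g : V -> W) (x h : V) :
  differentiable f x -> differentiable g x ->
  'd (fun y => f y - g y) x h = 'd f x h - 'd g x h.
Proof. by move=> df dg; rewrite -[fun y => _]/(f - g) diffB. Qed.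

(** * Estimates in several variables and uniform limits *)

Section Several.
Variable R : realType.
Local Notation C := (Cplx R).
Local Notation cabs := (@nrm R C^o).

(** Restriction to the complex line through [x] and [y], parametrized with a direction [w] of norm
    [r], puts [y] at parameter [|y - x| / r <= 1/2] and keeps the disc of radius 2 in the ball of
    radius [2 * r]. *)
Lemma cauchy_lipschitz (V : normedModType C) (f : V -> C^o) (x : V) (r M : R) : 0 < r ->
  (forall y, nrm (y - x) <= 2 * r -> differentiable f y) ->
  (forall y, nrm (y - x) <= 2 * r -> cabs (f y) <= M) ->
  forall y, nrm (y - x) <= r / 2 -> cabs (f y - f x) <= 8 * M / r * nrm (y - x).
Proof.
move=> r0 df fM y yx.
have [->|yx0] := eqVneq y x; first by rewrite !subrr !nrm0 mulr0.
have p0 : 0 < nrm (y - x) by rewrite nrm_gt0 // subr_eq0.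
pose w : V := toC (r / nrm (y - x)) *: (y - x).
have nw : nrm w = r.
  by rewrite nrmZ cabs_toC ger0_norm ?divr_ge0 ?nrm_ge0 ?(ltW r0) // divfK // gt_eqF.
pose mu : C^o := toC (nrm (y - x) / r).
have nmu : cabs mu = nrm (y - x) / r.
  by rewrite cabs_toC ger0_norm // divr_ge0 ?nrm_ge0 // ltW.
have muw : mu *: w = y - x.
  rewrite /w scalerA -toCM (_ : _ / r * _ = 1) ?scale1r //.
  by field; rewrite !gt_eqF.
pose h (z : C^o) : C^o := f (x + z *: w).
have near z : cabs z <= 2 -> nrm (x + z *: w - x) <= 2 * r.
  by move=> z2; rewrite addrAC subrr add0r nrmZ nw ler_pM2r.
have dh z : cabs z <= 2 -> differentiable h z.
  move=> z2; apply: (@differentiable_comp _ _ _ _ (fun z : C^o => x + z *: w) f).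
    by apply: differentiableD => //; apply: differentiableZl.
  by apply: df; apply: near.
have hM z : cabs z <= 2 -> cabs (h z) <= M by move=> /near; exact: fM.
have := lipschitz_at_origin dh hM (_ : cabs mu <= 1 / 2).
have xy : x + (y - x) = y by rewrite addrC subrK.
rewrite /h scale0r addr0 muw xy nmu mulrA [in X in _ -> X]mulrAC; apply.
by rewrite ler_pdivrMr // mul1r mulrC.
Qed.

Lemma diff_lip_bound (V W : normedModType C) (f : V -> W) (x : V) (r L : R) :
  0 < r -> differentiable f x ->
  (forall y, nrm (y - x) < r -> nrm (f y - f x) <= L * nrm (y - x)) ->
  forall h, nrm ('d f x h) <= L * nrm h.
Proof.
move=> r0 df fL h.
have [->|h0] := eqVneq h 0; first by rewrite linear0 !nrm0 mulr0.
have p0 : 0 < nrm h by rewrite nrm_gt0.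
apply/ler_addgt0Pr => e e0.
have [|d d0 dP] := diff_approx df (_ : 0 < e / nrm h); first by rewrite divr_gt0.
pose s := Num.min r d / (2 * nrm h).
have m0 : 0 < Num.min r d by rewrite lt_min r0.
have s0 : 0 < s by rewrite divr_gt0 // mulr_gt0.
have nsh : nrm (toC s *: h) = s * nrm h by rewrite nrmZ cabs_toC gtr0_norm.
have lt_m : s * nrm h < Num.min r d.
  by rewrite (_ : s * _ = Num.min r d / 2) /s; [lra | field; rewrite gt_eqF].
have /andP[lr ld] : (s * nrm h < r) && (s * nrm h < d) by rewrite -lt_min.
have := dP (toC s *: h); rewrite nsh => /(_ ld) le1.
have := fL (x + toC s *: h); rewrite addrAC subrr add0r nsh => /(_ lr) le2.
have nE : nrm ('d f x (toC s *: h)) = s * nrm ('d f x h).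
  by rewrite linearZ nrmZ cabs_toC gtr0_norm.
rewrite -(ler_pM2l s0) -nE.
move: le1 le2; set D := 'd f x _; set Df := f _ - f x => le1 le2.
have := nrmD (D - Df) Df; rewrite subrK (nrmB D) => le3.
apply: le_trans le3 _; apply: le_trans (lerD le1 le2) _.
by rewrite le_eqVlt; apply/orP; left; apply/eqP; field; rewrite gt_eqF.
Qed.

(** For real sequences the intervals around [a n] of radius [r n] meet pairwise, and the supremum of
    their left ends lies in all of them. Treating real and imaginary parts separately costs the
    factor 2. *)
Lemma cplx_complete (u : nat -> C^o) (r : nat -> R) :
  (forall m n, cabs (u m - u n) <= r m + r n) ->
  exists l : C^o, forall n, cabs (u n - l) <= 2 * r n.
Proof.
move=> ur.
have lim (a : nat -> R) : (forall m n, `|a m - a n| <= r m + r n) -> exists l, forall n, `|a n - l| <= r n.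
  move=> ar; pose S := range (fun n => a n - r n).
  have ub m : ubound S (a m + r m).
    by move=> _ [n _ <-]; have := ar n m; rewrite ler_norml => /andP[? ?]; lra.
  exists (sup S) => n; rewrite ler_norml.
  have h1 : a n - r n <= sup S by apply: ub_le_sup; [exists (a 0%N + r 0%N) | exists n].
  have h2 : sup S <= a n + r n by apply: ge_sup => //; exists (a 0%N - r 0%N), 0%N.
  by apply/andP; split; lra.
have [|a aP] := lim (fun n => ReC (u n)).
  by move=> m n; apply: le_trans (ur m n); rewrite -ReCN -ReCD ReC_le.
have [|b bP] := lim (fun n => ImC (u n)).
  by move=> m n; apply: le_trans (ur m n); rewrite -ImCN -ImCD ImC_le.
exists (mkC a b) => n; apply: le_trans (cabs_le _) _.
rewrite ReCD ImCD ReCN ImCN /= mulr_natl mulr2n.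
exact: lerD (aP n) (bP n).
Qed.

Lemma harmonic_lt (e : R) : 0 < e -> exists n : nat, n.+1%:R^-1 < e.
Proof.
move=> e0; exists (Num.truncn e^-1).
by rewrite invf_plt ?posrE ?ltr0n // truncnS_gt.
Qed.

(* The Lipschitz bound makes the differentials of the approximations a Cauchy
   sequence. *)
Lemma weierstrass (V : normedModType C) (f : V -> C^o) (x : V) (r : R) : 0 < r ->
  (forall e : R, 0 < e -> exists g : V -> C^o, forall y, nrm (y - x) <= r ->
     differentiable g y /\ cabs (g y - f y) <= e) ->
  differentiable f x.
Proof.
move=> r0 appr.
pose ee (n : nat) : R := n.+1%:R^-1.
have ee0 n : 0 < ee n by rewrite invr_gt0 ltr0n.
have /choice[g gP] : forall n : nat, exists g : V -> C^o, forall y, nrm (y - x) <= r ->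
     differentiable g y /\ cabs (g y - f y) <= ee n.
  by move=> n; apply: appr.
have xx : nrm (x - x) <= r by rewrite subrr nrm0 ltW.
(* The Lipschitz constant [8 * M / (r / 2)] on the ball of half the radius, with [M = ee m + ee n],
   is [K * M]. *)
pose K : R := 16 / r.
have K0 : 0 < K by rewrite divr_gt0.
have h0 : 0 < r / 2 by lra.
have lipmn m n y : nrm (y - x) <= r / 4 ->
    cabs ((g m y - g n y) - (g m x - g n x)) <= K * (ee m + ee n) * nrm (y - x).
  move=> yr.
  have := @cauchy_lipschitz V (fun y => g m y - g n y) x (r / 2) (ee m + ee n) h0 _ _ y.
  rewrite (_ : 8 * (ee m + ee n) / (r / 2) = K * (ee m + ee n)); last first.
    by rewrite /K; field; rewrite gt_eqF.
  apply; last by lra.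
  - move=> z zr; have zr' : nrm (z - x) <= r by lra.
    by apply: differentiableB; [exact: (gP m z zr').1 | exact: (gP n z zr').1].
  - move=> z zr; have zr' : nrm (z - x) <= r by lra.
    rewrite (_ : g m z - g n z = (g m z - f z) - (g n z - f z)); last by rewrite opprB addrA subrK.
    by apply: le_trans (nrmD _ _) _; rewrite nrmN lerD //; [exact: (gP m z zr').2 | exact: (gP n z zr').2].
pose A n := 'd (g n) x.
have Amn m n h : cabs (A m h - A n h) <= K * (ee m + ee n) * nrm h.
  have d1 := (gP m x xx).1; have d2 := (gP n x xx).1.
  have h4 : 0 < r / 4 by lra.
  rewrite -(diffB_at h d1 d2).
  exact: (diff_lip_bound h4 (differentiableB d1 d2) (fun y yr => lipmn m n y (ltW yr)) h).
have /choice[B BP] : forall h, exists l : C^o, forall n, cabs (A n h - l) <= 2 * (K * nrm h * ee n).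
  move=> h; apply: cplx_complete => m n; apply: le_trans (Amn m n h) _.
  by rewrite -mulrDr mulrAC.
have small c : 0 <= c -> forall e, 0 < e -> exists n, c * ee n < e.
  move=> c0 e e0; have [|n nP] := @harmonic_lt (e / (c + 1)); first by rewrite divr_gt0 //; lra.
  exists n; move: nP; rewrite ltr_pdivlMr; last lra.
  by rewrite -/(ee n) mulrDr mulr1 [_ * c]mulrC; have := ee0 n; lra.
have cabs0 (z : C^o) : (forall e, 0 < e -> cabs z <= e) -> z = 0.
  move=> ze; apply: nrm_eq0; apply/eqP; rewrite eq_le nrm_ge0 andbT.
  by apply/ler_addgt0Pr => e e0; rewrite add0r; exact: ze.
have linB : linear B.
  move=> a u v; apply/eqP; rewrite -subr_eq0; apply/eqP/cabs0 => e e0.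
  pose c := 2 * K * (nrm (a *: u + v) + cabs a * nrm u + nrm v).
  have c0 : 0 <= c.
    by rewrite /c mulr_ge0 //; [rewrite mulr_ge0 // ltW | rewrite !addr_ge0 ?mulr_ge0 ?nrm_ge0].
  have [n nP] := small c c0 e e0.
  have E : B (a *: u + v) - (a *: B u + B v) =
     - (A n (a *: u + v) - B (a *: u + v)) + (a *: (A n u - B u) + (A n v - B v)).
    have -> : A n (a *: u + v) = a *: A n u + A n v by exact: linearP.
    rewrite scalerBr.
    by move: (a *: A n u) (a *: B u) (A n v) (B v) (B _) => P P' q q' b; ring.
  rewrite E; apply: le_trans (nrmD _ _) _; rewrite nrmN.
  have := nrmD (a *: (A n u - B u)) (A n v - B v); rewrite nrmZ.
  have := BP (a *: u + v) n; have := BP u n; have := BP v n => b1 b2 b3 b4.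
  have b5 : cabs a * cabs (A n u - B u) <= cabs a * (2 * (K * nrm u * ee n)).
    by rewrite ler_wpM2l // nrm_ge0.
  apply: le_trans (ltW nP); rewrite /c; lra.
pose B' : {linear V -> C^o} := HB.pack B (GRing.isLinear.Build _ _ _ _ B linB).
have [K1 K10 A0P] := linear_bound (diff_continuous (gP 0%N x xx).1).
apply: (@approx_diff R V C^o f x B' (K1 + 2 * K) _ _).1.
  move=> h; rewrite -[B' h]/(B h).
  have := nrmD (A 0%N h) (- (A 0%N h - B h)); rewrite opprB addrC subrK nrmB => b1.
  have := BP h 0%N; rewrite /ee invr1 mulr1 => b2.
  have b3 : cabs (A 0%N h) <= K1 * nrm h := A0P h.
  rewrite mulrDl; lra.
move=> e e0.
have K50 : 0 <= 5 * K by lra.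
have e20 : 0 < e / 2 by lra.
have [n nP] := small (5 * K) K50 (e / 2) e20.
have [d d0 dP] := diff_approx (gP n x xx).1 e20.
exists (Num.min d (r / 4)); first by rewrite lt_min d0; lra.
move=> h; rewrite lt_min => /andP[hd hr]; rewrite -[B' h]/(B h).
(* The estimate [lipmn] passes to the limit in [m]: the terms with [ee m] are absorbed in an
   arbitrary [e1]. *)
have lim : cabs ((f (x + h) - f x) - (g n (x + h) - g n x)) <= K * ee n * nrm h.
  apply/ler_addgt0Pr => e1 e10.
  pose c := 2 + K * nrm h.
  have c0 : 0 <= c by rewrite addr_ge0 // mulr_ge0 ?nrm_ge0 // ltW.
  have [m mP] := small c c0 e1 e10.
  have xh : nrm (x + h - x) = nrm h by rewrite addrAC subrr add0r.
  have g1 := (gP m (x + h) _).2; rewrite xh in g1.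
  have hr' : nrm h <= r by lra.
  have {}g1 := g1 hr'; have g2 := (gP m x xx).2.
  have g3 := lipmn m n (x + h); rewrite xh in g3; have {}g3 := g3 (ltW hr).
  have -> : f (x + h) - f x - (g n (x + h) - g n x) =
     - (g m (x + h) - f (x + h)) + (g m x - f x) + (g m (x + h) - g n (x + h) - (g m x - g n x)) by ring.
  have := nrmD (- (g m (x + h) - f (x + h)) + (g m x - f x)) (g m (x + h) - g n (x + h) - (g m x - g n x)).
  have := nrmD (- (g m (x + h) - f (x + h))) (g m x - f x); rewrite nrmN.
  have E : K * (ee m + ee n) * nrm h = K * nrm h * ee m + K * ee n * nrm h by ring.
  rewrite E in g3; move: mP; rewrite /c mulrDl => mP; lra.
have -> : f (x + h) - f x - B h = (f (x + h) - f x - (g n (x + h) - g n x))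
   + ((g n (x + h) - g n x - A n h) + (A n h - B h)) by ring.
have := nrmD (f (x + h) - f x - (g n (x + h) - g n x)) ((g n (x + h) - g n x - A n h) + (A n h - B h)).
have := nrmD (g n (x + h) - g n x - A n h) (A n h - B h).
have := dP h hd; have := BP h n => b1 b2 b3 b4.
have b5 : 5 * K * ee n * nrm h <= e / 2 * nrm h by rewrite ler_wpM2r ?nrm_ge0 // ltW.
have E : 2 * (K * nrm h * ee n) = 2 * K * ee n * nrm h by ring.
rewrite E in b1.
have p1 : 0 <= K * ee n * nrm h by exact: (mulr_ge0 (mulr_ge0 (ltW K0) (ltW (ee0 n))) (nrm_ge0 h)).
have b6 : nrm (g n (x + h) - g n x - A n h) <= e / 2 * nrm h := b2.
lra.
Qed.

End Several.

(** * Hadamard division and implicit functions *)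

Lemma differentiable_bigsum (K : numFieldType) (V W : normedModType K) n (f : 'I_n -> V -> W) x :
  (forall i, differentiable (f i) x) -> differentiable (fun y => \sum_(i < n) f i y) x.
Proof. by move=> df; rewrite -fct_sumE; exact: differentiable_sum. Qed.

Lemma differentiable_affine (K : numFieldType) (V W : normedModType K) (f : V -> W) (A : {linear V ->
    W}) (a : W) (b x : V) :
  continuous A -> differentiable f x -> differentiable (fun y => f y - a - A (y - b)) x.
Proof.
move=> cA df; apply: differentiableB; first by apply: differentiableB.
apply: (@differentiable_comp _ _ _ _ (fun y => y - b) A); first exact: differentiableB.
exact: linear_differentiable.
Qed.

Lemma differentiable_shiftZ (K : numFieldType) (V W : normedModType K) (f : V -> W) (l : V -> K^o) (a :
    K) (b w : V) x :
  differentiable l x -> differentiable f (x - (a * l x) *: w + b) ->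
  differentiable (fun y => f (y - (a * l y) *: w + b)) x.
Proof.
move=> dl df; apply: (@differentiable_comp _ _ _ _ (fun y => y - (a * l y) *: w + b) f) => //.
apply: differentiableD => //; apply: differentiableB => //.
by apply: (@differentiableZl _ _ _ (fun y => a * l y)); apply: differentiableM.
Qed.

Lemma differentiable_comb (K : numFieldType) (V W : normedModType K) n (z : V -> W) (l : 'I_n -> V ->
    K^o) (v : 'I_n -> W) x :
  differentiable z x -> (forall i, differentiable (l i) x) ->
  differentiable (fun y => z y + \sum_(i < n) l i y *: v i) x.
Proof.
move=> dz dl; apply: differentiableD => //; apply: differentiable_bigsum => i.
exact: differentiableZl.
Qed.

Section Local.
Variable R : realType.
Local Notation C := (Cplx R).
Local Notation cabs := (@nrm R C^o).

Definition hol_ball (V W : normedModType C) (f : V -> W) (x : V) (r : R) :=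
  forall y, nrm (y - x) < r -> differentiable f y.

Lemma hol_ball_bounded (V : normedModType C) (f : V -> C^o) x r : 0 < r -> hol_ball f x r ->
  exists s M, [/\ 0 < s <= r, 0 < M & forall y, nrm (y - x) < s -> cabs (f y) <= M].
Proof.
move=> r0 df.
have /continuous_nrm /(_ 1 ltr01) [d d0 dP] : {for x, continuous f}.
  by apply: differentiable_continuous; apply: df; rewrite subrr nrm0.
exists (Num.min d r), (cabs (f x) + 1); split.
- by rewrite lt_min d0 r0 ge_min lexx orbT.
- by apply: ltr_wpDl; rewrite ?nrm_ge0.
move=> y; rewrite lt_min => /andP[/dP yd _].
by have := nrmD (f y - f x) (f x); rewrite subrK; lra.
Qed.

(** The Lipschitz estimate is used twice: on [f] it bounds the increment along [h] by a multiple of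
    [nrm h], and this bound serves as [M] for the increment, a function of the base point, moved by
    [k]. *)
Lemma second_difference (V : normedModType C) (f : V -> C^o) x0 r : 0 < r -> hol_ball f x0 r ->
  exists s K, [/\ 0 < s <= r, 0 < K & forall x h k, nrm (x - x0) < s -> nrm h < s -> nrm k < s ->
    cabs (f (x + k + h) - f (x + k) - (f (x + h) - f x)) <= K * nrm h * nrm k].
Proof.
move=> r0 df; have [s [M [/andP[s0 sr] M0 fM]]] := hol_ball_bounded r0 df.
have s8 : 0 < s / 8 by lra.
pose L := 8 * M / (s / 8).
have L0 : 0 < L by rewrite divr_gt0 // mulr_gt0.
have lip x h : nrm (x - x0) <= s / 2 -> nrm h <= s / 16 -> cabs (f (x + h) - f x) <= L * nrm h.
  move=> xs hs; have xh : nrm (x + h - x) = nrm h by rewrite addrAC subrr add0r.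
  rewrite -xh; apply: cauchy_lipschitz => // [y yx|y yx|]; last by rewrite xh; lra.
  - by apply: df; have := nrmBD x y x0; lra.
  - by apply: fM; have := nrmBD x y x0; lra.
exists (s / 16), (8 * L / (s / 8)); split; [lra | by rewrite divr_gt0 // mulr_gt0 |].
move=> x h k xs hs ks.
have xk : nrm (x + k - x) = nrm k by rewrite addrAC subrr add0r.
rewrite -xk; have -> : 8 * L / (s / 8) * nrm h = 8 * (L * nrm h) / (s / 8) by field; rewrite gt_eqF.
apply: (@cauchy_lipschitz _ _ (fun y => f (y + h) - f y) x (s / 8) (L * nrm h) s8) => [y yx|y yx|];
    last by rewrite xk; lra.
- apply: differentiableB; last by apply: df; have := nrmBD x y x0; lra.
  apply: (@differentiable_comp _ _ _ _ (fun y => y + h) f); first exact: differentiableD.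
  apply: df; have := nrmBD x (y + h) x0; have := nrmD (y - x) h; rewrite addrAC; lra.
- by apply: lip; [have := nrmBD x y x0; lra | lra].
Qed.

(** Cut [h] into [N.+1] equal steps [k]. By [second_difference] each increment of [f] differs from
    the first one by at most [K * nrm k * nrm h], which sums to [K * nrm h ^+ 2], while [N.+1] times
    the first increment approximates ['d f x h]. The constant is uniform in [x]. *)
Lemma taylor2 (V : normedModType C) (f : V -> C^o) x0 r : 0 < r -> hol_ball f x0 r ->
  exists s K, [/\ 0 < s <= r, 0 < K & forall x h, nrm (x - x0) < s -> nrm h < s ->
    cabs (f (x + h) - f x - 'd f x h) <= K * nrm h ^+ 2].
Proof.
move=> r0 df; have [s [K [s0 K0 sP]]] := second_difference r0 df.
exists s, K; split => // x h xs hs.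
apply/ler_addgt0Pr => e e0.
have [->|h0] := eqVneq h 0.
  by rewrite addr0 linear0 subr0 subrr !nrm0 expr0n mulr0 add0r ltW.
have p0 : 0 < nrm h by rewrite nrm_gt0.
have dfx : differentiable f x by apply: df; lra.
have [|d d0 dP] := diff_approx dfx (_ : 0 < e / nrm h); first by rewrite divr_gt0.
have [|N NP] := @harmonic_lt R (d / nrm h); first by rewrite divr_gt0.
pose k : V := toC N.+1%:R^-1 *: h.
have N0 : 0 < N.+1%:R :> R by rewrite ltr0n.
have nk : nrm k = N.+1%:R^-1 * nrm h by rewrite nrmZ cabs_toC gtr0_norm // invr_gt0.
have kd : nrm k < d by rewrite nk -ltr_pdivlMr.
have Nk : N.+1%:R * nrm k = nrm h by rewrite nk mulrA divff ?mul1r // gt_eqF.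
have NkE : k *+ N.+1 = h.
  rewrite -scaler_nat /k scalerA -toC_nat -toCM divff ?scale1r // gt_eqF //.
have kh : nrm k <= nrm h.
  by rewrite -Nk ler_peMl ?nrm_ge0 // ler1n.
have step j : (j <= N.+1)%N ->
    cabs (f (x + k *+ j) - f x - (f (x + k) - f x) *+ j) <= j%:R * (K * nrm k * nrm h).
  elim: j => [_|j IH jN]; first by rewrite !mulr0n addr0 !subrr nrm0 mul0r.
  have {}IH := IH (ltnW jN).
  have nkj : nrm (k *+ j) <= nrm h.
    rewrite -scaler_nat -toC_nat nrmZ cabs_toC ger0_norm ?ler0n // -Nk.
    by rewrite ler_wpM2r ?nrm_ge0 // ler_nat ltnW.
  have := sP x k (k *+ j) xs (le_lt_trans kh hs) (le_lt_trans nkj hs).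
  have -> : x + k *+ j + k = x + k *+ j.+1 by rewrite mulrSr addrA.
  move=> b1; have b2 : K * nrm k * nrm (k *+ j) <= K * nrm k * nrm h.
    by rewrite ler_wpM2l // mulr_ge0 ?nrm_ge0 // ltW.
  have -> : f (x + k *+ j.+1) - f x - (f (x + k) - f x) *+ j.+1 =
    (f (x + k *+ j) - f x - (f (x + k) - f x) *+ j)
    + (f (x + k *+ j.+1) - f (x + k *+ j) - (f (x + k) - f x)).
    rewrite mulrSr; move: (f (x + k *+ j)) (f (x + k *+ j.+1)) (_ *+ j) => a b c; ring.
  apply: le_trans (nrmD _ _) _; rewrite -natr1 mulrDl mul1r; lra.
have := step N.+1 (leqnn _); rewrite NkE => st.
have st2 : cabs ((f (x + k) - f x) *+ N.+1 - 'd f x h) <= e.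
  have -> : (f (x + k) - f x) *+ N.+1 - 'd f x h = (f (x + k) - f x - 'd f x k) *+ N.+1.
    have <- : 'd f x k *+ N.+1 = 'd f x h by rewrite -[in RHS]NkE; apply/esym; exact: linearMn.
    by apply: esym; exact: mulrnBl.
  rewrite -scaler_nat -toC_nat nrmZ cabs_toC ger0_norm ?ler0n //.
  have := dP k kd; rewrite -(ler_pM2l N0) => /le_trans; apply.
  by rewrite mulrCA Nk divfK // gt_eqF.
have := nrmD (f (x + h) - f x - (f (x + k) - f x) *+ N.+1) ((f (x + k) - f x) *+ N.+1 - 'd f x h).
rewrite addrA subrK => /le_trans; apply; apply: lerD st2.
apply: le_trans st _.
have -> : N.+1%:R * (K * nrm k * nrm h) = K * (N.+1%:R * nrm k) * nrm h by ring.
by rewrite Nk expr2 mulrA.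
Qed.

(* With D the derivative of F along w, the quotient is the integral over t in
   [0, 1] of D (e - t * l e *: w); its Riemann sums, with D replaced by a
   difference quotient, are holomorphic and converge uniformly. *)
Lemma hadamard_division (V : normedModType C) (F l : V -> C^o) (e0 w : V) (r : R) :
  0 < r -> hol_ball F e0 r -> hol_ball l e0 r -> l e0 = 0 ->
  exists s (G : V -> C^o), [/\ 0 < s, hol_ball G e0 s &
    forall e, nrm (e - e0) < s -> F e - F (e - l e *: w) = l e * G e].
Proof.
move=> r0 dF dl l0.
have [s [K [/andP[s0 sr] K0 tay]]] := taylor2 r0 dF.
(* Near [e0] this forces [|l| <= 1] and [|l| * nrm w <= s / 4], so the whole segment from [e] to
   [e - l e *: w] stays where [taylor2] applies. *)
have ep : 0 < Num.min 1 (s / (4 * (nrm w + 1))).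
  by rewrite lt_min ltr01 divr_gt0 // mulr_gt0 //; have := nrm_ge0 w; lra.
have /continuous_nrm /(_ _ ep) [d d0 dP] : {for e0, continuous l}.
  by apply: differentiable_continuous; apply: dl; rewrite subrr nrm0.
pose q := Num.min d (s / 4).
have q0 : 0 < q by rewrite lt_min d0 /=; lra.
have near e : nrm (e - e0) < q -> [/\ nrm (e - e0) < s / 4, cabs (l e) <= 1 & cabs (l e) * nrm w <= s / 4].
  rewrite lt_min => /andP[ed es]; have := dP e ed.
  rewrite l0 subr0 lt_min => /andP[l1 l2]; split => //; first exact: ltW.
  have w1 : 0 < nrm w + 1 by have := nrm_ge0 w; lra.
  move: l2; rewrite ltr_pdivlMr ?mulr_gt0 // => l2.
  have := nrm_ge0 (l e : C^o); lra.
(* On the zero set of [l] the quotient is completed by the derivative along [w], the limit of the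
   Riemann sums there. *)
pose G e : C^o := if l e == 0 then 'd F e w else (F e - F (e - l e *: w)) / l e.
exists q, G; split => //; last first.
  move=> e _; rewrite /G; case: eqP => [->|/eqP le0]; first by rewrite scale0r subr0 subrr mul0r.
  by rewrite mulrC divfK.
move=> e ee.
have qe0 : 0 < (q - nrm (e - e0)) / 2 by lra.
apply: (weierstrass qe0) => c c0.
pose KW := 2 * K * nrm w ^+ 2.
have KW0 : 0 <= KW by rewrite mulr_ge0 ?sqr_ge0 // mulr_ge0 // ltW.
have KW10 : 0 < KW + 1 by lra.
have w10 : 0 < nrm w + 1 by have := nrm_ge0 w; lra.
have [|N NP] := @harmonic_lt R (Num.min (c / (KW + 1)) (s / (2 * (nrm w + 1)))).
  by rewrite lt_min !divr_gt0 // mulr_gt0.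
move: NP; set n := N.+1; rewrite lt_min => /andP[Nc Nw].
have n0 : 0 < n%:R :> R by rewrite ltr0n.
pose pt (k : nat) y := y - (toC (k%:R / n%:R) * l y) *: w.
pose b : V := toC n%:R^-1 *: w.
have nb : nrm b = n%:R^-1 * nrm w by rewrite nrmZ cabs_toC gtr0_norm // invr_gt0.
have bs : nrm b < s.
  rewrite nb; have w1 : 0 < nrm w + 1 by have := nrm_ge0 w; lra.
  move: Nw; rewrite ltr_pdivlMr ?mulr_gt0 // => Nw.
  have : 0 < n%:R^-1 :> R by rewrite invr_gt0.
  lra.
have bs2 : nrm b <= s / 2.
  rewrite nb; have w1 : 0 < nrm w + 1 by have := nrm_ge0 w; lra.
  move: Nw; rewrite ltr_pdivlMr ?mulr_gt0 // => Nw.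
  have : 0 < n%:R^-1 :> R by rewrite invr_gt0.
  lra.
have ptn k y : (k < n)%N -> nrm (y - e0) < q -> nrm (pt k y - e0) < s / 2.
  move=> kn /near[y1 y2 y3].
  have := nrmD (y - e0) (- ((toC (k%:R / n%:R) * l y) *: w)).
  rewrite nrmN nrmZ cabsM cabs_toC ger0_norm ?divr_ge0 // addrAC -/(pt k y) => b1.
  have b2 : k%:R / n%:R * (cabs (l y) * nrm w) <= cabs (l y) * nrm w.
    rewrite ler_piMl ?mulr_ge0 ?nrm_ge0 // ler_pdivrMr // mul1r ler_nat ltnW //.
  rewrite mulrA in b2; lra.
(* The difference quotient with step [1 / n] cancels the mesh [1 / n] of the Riemann sum. The [+ 0]
   gives both terms the shape of [differentiable_shiftZ]. *)
exists (fun y => \sum_(k < n) (F (pt k y + b) - F (pt k y + 0))).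
move=> y ye; have yq : nrm (y - e0) < q by have := nrmBD e y e0; lra.
have [y1 y2 y3] := near y yq.
split.
  apply: differentiable_bigsum => k; have pk := ptn k y (ltn_ord k) yq.
  apply: differentiableB; apply: differentiable_shiftZ.
  - by apply: dl; lra.
  - by apply: dF; rewrite -/(pt k y) addrAC; have := nrmD (pt k y - e0) b; lra.
  - by apply: dl; lra.
  - by apply: dF; rewrite -/(pt k y) addr0; lra.
have KW1 : KW / n%:R <= c.
  have : 0 < KW + 1 by lra.
  move=> kw; move: Nc; rewrite ltr_pdivlMr // => Nc.
  have : 0 < n%:R^-1 :> R by rewrite invr_gt0.
  rewrite mulrC; lra.
have quot k : (k < n)%N -> cabs (F (pt k y + b) - F (pt k y) - 'd F (pt k y) b) <= K * nrm b ^+ 2.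
  by move=> kn; apply: tay => //; have := ptn k y kn yq; lra.
have nb2 : n%:R * (K * nrm b ^+ 2) = K * nrm w ^+ 2 / n%:R.
  by rewrite nb; field; rewrite gt_eqF.
have wK : K * nrm w ^+ 2 / n%:R <= KW / n%:R.
  by rewrite ler_pM2r ?invr_gt0 //; move: KW0; rewrite /KW; lra.
rewrite /G; have [ly0|ly0] := eqVneq (l y) 0.
  have -> : \sum_(k < n) (F (pt k y + b) - F (pt k y + 0)) - 'd F y w = \sum_(k < n) (F (pt k y + b) -
      F (pt k y) - 'd F (pt k y) b).
    rewrite [RHS]big_split /=; congr (_ + _); first by apply: eq_bigr => k _; rewrite addr0.
    rewrite (eq_bigr (fun=> - 'd F y b)); last by move=> k _; rewrite /pt ly0 mulr0 scale0r subr0.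
    have -> : 'd F y w = 'd F y (b *+ n); last first.
      by rewrite sumr_const card_ord mulNrn; congr (- _); exact: linearMn.
    congr ('d F y _).
    by rewrite /b -scaler_nat scalerA -toC_nat -toCM divff ?scale1r // gt_eqF.
  apply: le_trans KW1; apply: le_trans wK; rewrite -nb2.
  have : cabs (\sum_(k < n) (F (pt k y + b) - F (pt k y) - 'd F (pt k y) b)) <= \sum_(k < n) (K * nrm b
      ^+ 2).
    elim/big_ind2: _ => [|z1 z2 z3 z4 h1 h2|k _]; first by rewrite nrm0.
      by apply: le_trans (nrmD _ _) _; exact: lerD.
    exact: quot.
  by rewrite sumr_const card_ord mulr_natl.
have pt0 : pt 0%N y = y by rewrite /pt mul0r mul0r scale0r subr0.
have ptn1 : pt n y = y - l y *: w by rewrite /pt divff ?gt_eqF // mul1r.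
have ptS k : pt k.+1 y = pt k y + (- l y) *: b.
  rewrite /pt -addrA; congr (_ + _); rewrite /b scalerA.
  have -> : toC (k.+1%:R / n%:R) * l y = toC (k%:R / n%:R) * l y + l y * toC n%:R^-1.
    by rewrite -natr1 mulrDl toCD mul1r; ring.
  by rewrite scalerDl opprD mulNr scaleNr.
(* The numerator telescopes along the points [pt k y], whose steps are [- l y *: b]. After division
   by [l y], a term differs from that of the Riemann sum by two remainders of [taylor2], each at
   most [K * nrm b ^+ 2] because [|l y| <= 1]. *)
have tele : F y - F (y - l y *: w) = \sum_(k < n) (F (pt k y) - F (pt k.+1 y)).
  rewrite -(big_mkord xpredT (fun k => F (pt k y) - F (pt k.+1 y))).
  have -> : \sum_(0 <= k < n) (F (pt k y) - F (pt k.+1 y)) = - \sum_(0 <= k < n) (F (pt k.+1 y) - F (pt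
      k y)).
    by rewrite -sumrN; apply: eq_bigr => k _; rewrite opprB.
  by rewrite (telescope_sumr (fun k => F (pt k y))) // opprB pt0 ptn1.
have hs2 : s / 2 < s by lra.
have term k : (k < n)%N ->
    cabs (F (pt k y + b) - F (pt k y + 0) - (F (pt k y) - F (pt k.+1 y)) / l y) <= 2 * (K * nrm b ^+ 2).
  move=> kn; rewrite addr0.
  have q1 := quot k kn; have p2 := ptn k y kn yq.
  have nlb : nrm ((- l y) *: b) = cabs (l y) * nrm b by rewrite nrmZ nrmN.
  have lb : cabs (l y) * nrm b <= nrm b by rewrite ler_piMl ?nrm_ge0.
  have := tay (pt k y) ((- l y) *: b); rewrite nlb -ptS => /(_ _ _) q2.
  have {}q2 := q2 (lt_trans p2 hs2) (le_lt_trans lb bs).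
  have dE : 'd F (pt k y) ((- l y) *: b) = (- l y) * 'd F (pt k y) b by exact: linearZ.
  have -> : F (pt k y + b) - F (pt k y) - (F (pt k y) - F (pt k.+1 y)) / l y =
    (F (pt k y + b) - F (pt k y) - 'd F (pt k y) b)
    + (F (pt k.+1 y) - F (pt k y) - 'd F (pt k y) ((- l y) *: b)) / l y.
    by rewrite dE; field.
  apply: le_trans (nrmD _ _) _; rewrite [2 * _]mulr_natl mulr2n; apply: lerD q1 _.
  rewrite cabsM cabsV ler_pdivrMr ?nrm_gt0 //; apply: le_trans q2 _.
  have l2 : cabs (l y) ^+ 2 <= cabs (l y) by rewrite expr2 ler_piMl ?nrm_ge0.
  have := ler_wpM2l (mulr_ge0 (ltW K0) (sqr_ge0 (nrm b))) l2.
  by congr (_ <= _); ring.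
rewrite tele mulr_suml -sumrB.
have : cabs (\sum_(k < n) (F (pt k y + b) - F (pt k y + 0) - (F (pt k y) - F (pt k.+1 y)) / l y)) <=
    \sum_(k < n) (2 * (K * nrm b ^+ 2)).
  elim/big_ind2: _ => [|z1 z2 z3 z4 h1 h2|k _]; first by rewrite nrm0.
    by apply: le_trans (nrmD _ _) _; exact: lerD.
  exact: term.
rewrite sumr_const card_ord -[_ *+ n]mulr_natl mulrCA nb2 => /le_trans; apply.
by apply: le_trans KW1; rewrite /KW !mulrA.
Qed.

End Local.

(** * Strict differentiability and implicit functions *)

Section Implicit.
Variable R : realType.
Local Notation C := (Cplx R).
Local Notation cabs := (@nrm R C^o).

Lemma uniform_radius (I : finType) (P : I -> R -> Prop) :
  (forall i, exists2 d, 0 < d & forall e, 0 < e <= d -> P i e) ->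
  exists2 d, 0 < d & forall i e, 0 < e <= d -> P i e.
Proof.
move=> PE.
have /choice[d dP] : forall i, exists d, 0 < d /\ forall e, 0 < e <= d -> P i e.
  by move=> i; have [d d0 dP] := PE i; exists d.
pose d0 := \big[Num.min/1]_i d i.
exists d0.
  rewrite /d0; elim/big_ind: _ => [|a b a0 b0|i _]; rewrite ?lt_min ?a0 //.
  by have [] := dP i.
move=> i e /andP[e0 ed]; apply: (dP i).2; rewrite e0.
by apply: le_trans ed _; rewrite /d0 (bigD1 i) //= ge_min lexx.
Qed.

(** The error [g] of the affine approximation at [z0] is at most [e / 32 * (s / 2)] near [z0]; the
    Lipschitz estimate with radius [s / 8] turns this into Lipschitz constant [e]. *)
Lemma strictly_differentiable (V : normedModType C) (f : V -> C^o) (z0 : V) (r : R) : 0 < r ->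
  hol_ball f z0 r -> forall e, 0 < e -> exists2 d, 0 < d & forall y y',
    nrm (y - z0) < d -> nrm (y' - z0) < d ->
    cabs (f y - f y' - 'd f z0 (y - y')) <= e * nrm (y - y').
Proof.
move=> r0 df e e0.
have df0 : differentiable f z0 by apply: df; rewrite subrr nrm0.
have [|d d0 dP] := diff_approx df0 (_ : 0 < e / 32); first by lra.
pose s := Num.min d r.
have s0 : 0 < s by rewrite lt_min d0.
have s32 : 0 < s / 32 by lra.
have s8 : 0 < s / 8 by lra.
exists (s / 32) => // y y' ys y's.
pose g y := f y - f z0 - 'd f z0 (y - z0).
have -> : f y - f y' - 'd f z0 (y - y') = g y - g y'.
  have -> : 'd f z0 (y - y') = 'd f z0 (y - z0) - 'd f z0 (y' - z0).
    by rewrite -[y - y'](subrKA z0) -[z0 - y']opprB; exact: linearB.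
  by rewrite /g; ring.
have gP z : nrm (z - z0) < s -> cabs (g z) <= e / 32 * nrm (z - z0).
  rewrite lt_min => /andP[zd _]; have := dP (z - z0) zd.
  by rewrite [z0 + _]addrC subrK.
have := @cauchy_lipschitz R V g y' (s / 8) (e / 32 * (s / 2)) s8.
have -> : 8 * (e / 32 * (s / 2)) / (s / 8) = e by field; rewrite gt_eqF.
apply.
- move=> z zy; apply: differentiable_affine; first exact: diff_continuous.
  apply: df; have := nrmBD y' z z0; have : s <= r by rewrite ge_min lexx orbT.
  lra.
- move=> z zy; have h := nrmBD y' z z0.
  apply: le_trans (gP z _) _; first by lra.
  by rewrite ler_wpM2l //; lra.
- by have := nrmBD z0 y y'; rewrite (nrmB z0); lra.
Qed.

Lemma geometric_lt (c e : R) : 0 <= c -> 0 < e -> exists n : nat, c * (2 ^+ n)^-1 < e.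
Proof.
move=> c0 e0; have [|n nP] := @harmonic_lt R (e / (c + 1)); first by rewrite divr_gt0 //; lra.
exists n; have p0 : 0 < (2 ^+ n)^-1 :> R by rewrite invr_gt0 exprn_gt0.
have c10 : 0 < c + 1 by lra.
have : (2 ^+ n)^-1 <= n.+1%:R^-1 :> R.
  by rewrite lef_pV2 ?posrE ?exprn_gt0 ?ltr0n // -natrX ler_nat ltn_expl.
move: nP; rewrite ltr_pdivlMr // => nP nn.
have : (2 ^+ n)^-1 * (c + 1) < e by apply: le_lt_trans nP; rewrite ler_pM2r.
lra.
Qed.

(* The solution is the limit of the iteration lam := lam - (tau (z + lam v) -
   tau z - c), whose iterates are holomorphic and converge uniformly. *)
Lemma implicit_solution (V E : normedModType C) (r : nat) (tau : 'I_r -> V -> C^o)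
    (v : 'I_r -> V) (z0 : V) (r0 : R) (zf : E -> V) (cf : 'I_r -> E -> C^o) (e0 : E) (r1 : R) :
  0 < r0 -> (forall i, hol_ball (tau i) z0 r0) ->
  (forall i j, 'd (tau i) z0 (v j) = (i == j)%:R) ->
  0 < r1 -> hol_ball zf e0 r1 -> (forall i, hol_ball (cf i) e0 r1) ->
  zf e0 = z0 -> (forall i, cf i e0 = 0) ->
  exists s (lam : 'I_r -> E -> C^o), [/\ 0 < s, forall i, hol_ball (lam i) e0 s,
    forall e, nrm (e - e0) < s -> forall i,
      tau i (zf e + \sum_j lam j e *: v j) = tau i (zf e) + cf i e &
    forall e, nrm (e - e0) < s -> (forall i, cf i e = 0) -> forall i, lam i e = 0].
Proof.
move=> r00 dtau tauv r10 dzf dcf zf0 cf0.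
pose S := \sum_j nrm (v j) + 1.
have S1 : 1 <= S by rewrite lerDr sumr_ge0 // => j _; exact: nrm_ge0.
have S0 : 0 < S by lra.
(* A combination of the [v j] with coefficients bounded by [D] has norm at most [S * D], so the
   factor [1 / (2 * S)] makes the iteration contract by 1/2. *)
have [|d d0 dP] := @uniform_radius 'I_r (fun i d => forall y y', nrm (y - z0) < d -> nrm (y' - z0) < d ->
    cabs (tau i y - tau i y' - 'd (tau i) z0 (y - y')) <= 1 / (2 * S) * nrm (y - y')).
  move=> i; have [|d d0 dP] := strictly_differentiable r00 (dtau i) (_ : 0 < 1 / (2 * S)).
    by rewrite divr_gt0 // mulr_gt0.
  by exists d => // e /andP[e1 ed] y y' yd y'd; apply: dP; lra.
pose q := Num.min d r0.
have q0 : 0 < q by rewrite lt_min d0.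
have qd : q <= d by rewrite ge_min lexx.
have qr : q <= r0 by rewrite ge_min lexx orbT.
(* Coefficients up to [2 * del] move a point by at most [q / 4], hence from within [q / 2] of [z0]
   to within [q]. *)
pose del := q / (8 * S).
have del0 : 0 < del by rewrite divr_gt0 // mulr_gt0.
have delS : S * (2 * del) = q / 4 by rewrite /del; field; rewrite gt_eqF.
have normL (a : 'I_r -> C^o) D : 0 <= D -> (forall i, cabs (a i) <= D) -> nrm (\sum_j a j *: v j) <= S * D.
  move=> D0 aD; apply: (@le_trans _ _ (\sum_j D * nrm (v j))).
    elim/big_ind2: _ => [|z1 z2 z3 z4 h1 h2|k _]; first by rewrite nrm0.
      by apply: le_trans (nrmD _ _) _; exact: lerD.
    by rewrite nrmZ ler_wpM2r // nrm_ge0.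
  by rewrite -mulr_sumr /S mulrDl mul1r mulrC; lra.
have diffL i (a b : 'I_r -> C^o) :
    'd (tau i) z0 (\sum_j a j *: v j - \sum_j b j *: v j) = a i - b i.
  rewrite -sumrB (eq_bigr (fun j => (a j - b j) *: v j)); last by move=> j _; rewrite scalerBl.
  have -> : 'd (tau i) z0 (\sum_j (a j - b j) *: v j) = \sum_j (a j - b j) * (i == j)%:R.
    rewrite (linear_sum ('d (tau i) z0)); apply: eq_bigr => j _.
    by rewrite -tauv; exact: linearZ.
  rewrite (bigD1 i) //= eqxx mulr1 big1 ?addr0 // => j ji.
  by rewrite eq_sym (negbTE ji) mulr0.
have del20 : 0 <= 2 * del by lra.
have near (z : V) (c : 'I_r -> C^o) : nrm (z - z0) < q / 2 -> (forall i, cabs (c i) <= 2 * del) ->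
    nrm (z + \sum_j c j *: v j - z0) < q.
  move=> zq cB; have := normL c (2 * del) del20 cB.
  by have := nrmD (z - z0) (\sum_j c j *: v j); rewrite addrAC; lra.
have contr (z : V) (a b : 'I_r -> C^o) D : nrm (z - z0) < q / 2 ->
    (forall i, cabs (a i) <= 2 * del) -> (forall i, cabs (b i) <= 2 * del) ->
    (forall i, cabs (a i - b i) <= D) -> forall i,
    cabs (a i - b i - (tau i (z + \sum_j a j *: v j) - tau i (z + \sum_j b j *: v j))) <= D / 2.
  move=> zq aB bB abD i.
  have D0 : 0 <= D by apply: le_trans (abD i); exact: nrm_ge0.
  have := dP i d; rewrite d0 lexx => /(_ isT _ _ (lt_le_trans (near z a zq aB) qd) (lt_le_trans (near z
      b zq bB) qd)).
  have -> : z + \sum_j a j *: v j - (z + \sum_j b j *: v j) = \sum_j a j *: v j - \sum_j b j *: v j.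
    by rewrite opprD addrACA subrr add0r.
  rewrite diffL nrmB => le1; apply: le_trans le1 _.
  have := normL (fun j => a j - b j) D D0 abD.
  rewrite (eq_bigr (fun j => a j *: v j - b j *: v j)); last by move=> j _; rewrite scalerBl.
  rewrite sumrB => le2.
  have S20 : 0 < 2 * S by rewrite mulr_gt0.
  rewrite div1r mulrC ler_pdivrMr //; apply: le_trans le2 _.
  by rewrite le_eqVlt; apply/orP; left; apply/eqP; field.
pose T (e : E) (a : 'I_r -> C^o) : 'I_r -> C^o :=
  fun i => a i - (tau i (zf e + \sum_j a j *: v j) - tau i (zf e) - cf i e).
pose L m (i : 'I_r) (e : E) : C^o := iter m (T e) (fun=> 0) i.
pose gm (m : nat) : R := (2 ^+ m)^-1.
have gm0 m : 0 < gm m by rewrite invr_gt0 exprn_gt0.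
have gmS m : gm m.+1 = gm m / 2 by rewrite /gm exprS invfM mulrC.
have [s s0 [sr sz sc]] : exists2 s, 0 < s & [/\ s <= r1, forall e, nrm (e - e0) < s -> nrm (zf e - z0)
    < q / 2 &
    forall e, nrm (e - e0) < s -> forall i, cabs (cf i e) <= del / 2].
  have h0 : 0 < q / 2 by lra.
  have /continuous_nrm /(_ _ h0) [sz sz0 szP] : {for e0, continuous zf}.
    by apply: differentiable_continuous; apply: dzf; rewrite subrr nrm0.
  have h1 : 0 < del / 2 by lra.
  have [|sc sc0 scP] := @uniform_radius 'I_r (fun i s => forall e, nrm (e - e0) < s -> cabs (cf i e) <=
      del / 2).
    move=> i; have /continuous_nrm /(_ _ h1) [s' s'0 s'P] : {for e0, continuous (cf i)}.
      by apply: differentiable_continuous; apply: dcf; rewrite subrr nrm0.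
    exists s' => // e' /andP[_ e's] e ee; apply: ltW.
    by have := s'P e; rewrite cf0 subr0; apply; lra.
  exists (Num.min (Num.min sz sc) r1); first by rewrite !lt_min sz0 sc0.
  split; first by rewrite ge_min lexx orbT.
    by move=> e; rewrite !lt_min => /andP[/andP[e1 _] _]; rewrite -zf0; exact: szP.
  move=> e; rewrite !lt_min => /andP[/andP[_ e1] _] i.
  by apply: (scP i sc) => //; rewrite sc0 lexx.
(* The first increment is [cf i e], at most [del / 2], and the bound halves each time, so the
   iterates stay below [del]. *)
have iter_bound e : nrm (e - e0) < s -> forall m i,
    cabs (L m i e) <= del * (1 - gm m) /\ cabs (L m.+1 i e - L m i e) <= del / 2 * gm m.
  move=> es; elim=> [|m IH] i.
    rewrite /L /= nrm0 /gm invr1 subrr mulr0 lexx /T mulr1; split => //.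
    rewrite big1 ?addr0; last by move=> j _; rewrite scale0r.
    by rewrite subrr !sub0r opprK subr0; exact: sc.
  have b1 : forall i, cabs (L m i e) <= 2 * del.
    by move=> j; apply: le_trans (IH j).1 _; have := gm0 m; nra.
  have b2 j : cabs (L m.+1 j e) <= del * (1 - gm m.+1).
    have := nrmD (L m.+1 j e - L m j e) (L m j e); rewrite subrK.
    by have [] := IH j; rewrite gmS; lra.
  have b3 j : cabs (L m.+1 j e) <= 2 * del.
    by apply: le_trans (b2 j) _; have := gm0 m.+1; nra.
  split=> //.
  have := contr (zf e) (fun j => L m.+1 j e) (fun j => L m j e) _ (sz e es) b3 b1 (fun j => (IH j).2) i.
  have -> : L m.+1 i e - L m i e - (tau i (zf e + \sum_j L m.+1 j e *: v j) - tau i (zf e + \sum_j L m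
      j e *: v j))
     = L m.+2 i e - L m.+1 i e.
    by rewrite /L !iterS -/(L m.+1) /T -/(L m.+1 _ _) -/(L m _ _); ring.
  by rewrite gmS; lra.
have boundL e : nrm (e - e0) < s -> forall m i, cabs (L m i e) <= 2 * del.
  by move=> es m i; apply: le_trans (iter_bound e es m i).1 _; have := gm0 m; nra.
have LS m i e : L m.+1 i e = L m i e - (tau i (zf e + \sum_j L m j e *: v j) - tau i (zf e) - cf i e).
  by [].
have dL m : forall i, hol_ball (L m i) e0 s.
  elim: m => [|m IH] i e es; first exact: differentiable_cst.
  have dz : differentiable zf e by apply: dzf; lra.
  change (differentiable (fun e => L m i e -
    (tau i (zf e + \sum_j L m j e *: v j) - tau i (zf e) - cf i e)) e).
  apply: differentiableB; first exact: IH.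
  apply: differentiableB; last by apply: dcf; lra.
  apply: differentiableB.
    apply: (@differentiable_comp _ _ _ _ (fun e => zf e + \sum_j L m j e *: v j) (tau i)).
      by apply: differentiable_comb => // j; exact: IH.
    by apply: dtau; apply: lt_le_trans qr; apply: near; [exact: sz | exact: boundL].
  apply: (@differentiable_comp _ _ _ _ zf (tau i)) => //.
  by apply: dtau; have := sz e es; lra.
have tail e m k i : nrm (e - e0) < s -> cabs (L (m + k)%N i e - L m i e) <= del * (gm m - gm (m + k)%N).
  move=> es; elim: k => [|k IH]; first by rewrite addn0 !subrr nrm0 mulr0.
  have := nrmBD (L (m + k)%N i e) (L (m + k).+1 i e) (L m i e).
  by have := (iter_bound e es (m + k)%N i).2; rewrite addnS (gmS (m + k)%N); lra.
have cauchyL e m n i : nrm (e - e0) < s -> cabs (L m i e - L n i e) <= del * gm m + del * gm n.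
  move=> es; have p0 := mulr_gt0 del0 (gm0 m); have p1 := mulr_gt0 del0 (gm0 n).
  case: (leqP m n) => [mn|/ltnW nm].
    by have := tail e m (n - m)%N i es; rewrite subnKC // nrmB; lra.
  by have := tail e n (m - n)%N i es; rewrite subnKC //; lra.
have /choice[lam lamP] : forall p : 'I_r * E, exists l : C^o, nrm (p.2 - e0) < s ->
    forall n, cabs (L n p.1 p.2 - l) <= 2 * (del * gm n).
  move=> [i e]; have [es|_] := ltP (nrm (e - e0)) s; last by exists 0.
  by have [m n|l lP] := @cplx_complete R (fun n => L n i e) (fun n => del * gm n); [exact: cauchyL |
      exists l].
have {}lamP i e : nrm (e - e0) < s -> forall n, cabs (L n i e - lam (i, e)) <= 2 * (del * gm n).
  by move=> es; exact: (lamP (i, e)).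
have small c : 0 < c -> exists n, 2 * (del * gm n) < c.
  by move=> c0; have [n nP] := geometric_lt del20 c0; exists n; rewrite mulrA.
have eq0 (z : C^o) : (forall n, cabs z <= 2 * (2 * (del * gm n))) -> z = 0.
  move=> zn; apply: nrm_eq0; apply/eqP; rewrite eq_le nrm_ge0 andbT.
  apply/ler_addgt0Pr => c c0; rewrite add0r; have [|n nP] := small (c / 2); first lra.
  by apply: le_trans (zn n) _; lra.
exists s, (fun i e => lam (i, e)); split => //.
- move=> i e es; have ss : 0 < (s - nrm (e - e0)) / 2 by lra.
  apply: (weierstrass ss) => c /small[n nP]; exists (L n i) => y ye.
  have ys : nrm (y - e0) < s by have := nrmBD e y e0; lra.
  by split; [exact: dL | apply: le_trans (lamP i y ys n) _; exact: ltW].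
(* The residual of the equation at [L n] is [L n - L n.+1]; the contraction estimate carries it to
   the limit up to a multiple of [gm n]. *)
- move=> e es i; apply/eqP; rewrite -subr_eq0 opprD addrA; apply/eqP/eq0 => n.
  have b1 j : cabs (lam (j, e)) <= 2 * del.
    by have := lamP j e es 0%N; rewrite /L /= sub0r nrmN /gm invr1 mulr1.
  have b2 j : cabs (lam (j, e) - L n j e) <= 2 * (del * gm n) by rewrite nrmB; exact: lamP.
  have c1 := contr (zf e) _ _ _ (sz e es) b1 (boundL e es n) b2 i.
  have c2 := (iter_bound e es n i).2.
  have -> : tau i (zf e + \sum_j lam (j, e) *: v j) - tau i (zf e) - cf i e =
    - (lam (i, e) - L n i e - (tau i (zf e + \sum_j lam (j, e) *: v j) - tau i (zf e + \sum_j L n j e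
        *: v j)))
    + ((lam (i, e) - L n i e) - (L n.+1 i e - L n i e)) by rewrite LS; ring.
  have := nrmD (- (lam (i, e) - L n i e - (tau i (zf e + \sum_j lam (j, e) *: v j) - tau i (zf e +
      \sum_j L n j e *: v j)))) ((lam (i, e) - L n i e) - (L n.+1 i e - L n i e)).
  have := nrmD (lam (i, e) - L n i e) (- (L n.+1 i e - L n i e)).
  have p0 := mulr_gt0 del0 (gm0 n); have := b2 i; rewrite !nrmN; lra.
(* For [c = 0] the iteration never leaves 0. This clause is what later gives [Y (z, 0) = z]. *)
- move=> e es ce i; have L0 n : forall j, L n j e = 0.
    elim: n => [//|n IH] j; rewrite LS IH ce.
    rewrite big1 ?addr0 ?subrr ?subr0 // => k _; first by rewrite IH scale0r.
  apply: eq0 => n; have := lamP i e es n; rewrite L0 sub0r nrmN.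
  by have := mulr_gt0 del0 (gm0 n); lra.
Qed.

End Implicit.

Lemma differentiable_fst (K : numFieldType) (V W : normedModType K) (x : V * W) :
  differentiable (fst : V * W -> V) x.
Proof. by apply: linear_differentiable => y; exact: cvg_fst. Qed.

Lemma differentiable_snd (K : numFieldType) (V W : normedModType K) (x : V * W) :
  differentiable (snd : V * W -> W) x.
Proof. by apply: linear_differentiable => y; exact: cvg_snd. Qed.

Lemma differentiable_graph (K : numFieldType) (V W W' : normedModType K) (G : V * W -> W') (g : V -> W) x :
  differentiable g x -> differentiable G (x, g x) -> differentiable (fun y => G (y, g y)) x.
Proof.
move=> dg dG; apply: (@differentiable_comp _ _ _ _ (fun y => (y, g y)) G) => //.
exact: differentiable_pair.
Qed.

(** * Moving one coordinate: density and local retractions *)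

Section LocalSplit.
Variable R : realType.
Local Notation C := (Cplx R).
Local Notation cabs := (@nrm R C^o).

Lemma nrm_pair (V W : normedModType C) (a : V) (b : W) :
  nrm ((a, b) : V * W) = Num.max (nrm a) (nrm b).
Proof.
apply: toC_inj; rewrite -nrmE prod_normE /= !nrmE.
by rewrite !maxEle toC_le; case: ifP.
Qed.

Section Chart.
Variables (V : normedModType C) (r : nat) (tau : 'I_r -> V -> C^o) (v : 'I_r -> V) (z0 : V) (r0 : R).
Hypothesis r00 : 0 < r0.
Hypothesis dtau : forall i, hol_ball (tau i) z0 r0.
Hypothesis tauv : forall i j, 'd (tau i) z0 (v j) = (i == j)%:R.

Definition single (k : 'I_r) (c : C^o) (i : 'I_r) : C^o := if i == k then c else 0.

Lemma differentiable_single (E : normedModType C) (k i : 'I_r) (g : E -> C^o) x :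
  differentiable g x -> differentiable (fun e => single k (g e) i) x.
Proof.
by rewrite /single; case: (i == k) => // _; exact: differentiable_cst.
Qed.

(** The implicit function theorem adds a small number [c] to the [k]-th coordinate alone; the
    solution tends to [z0] with [c]. *)
Lemma move_coordinate (k : 'I_r) (e : R) : 0 < e -> exists y, [/\ nrm (y - z0) < e,
  forall i, i != k -> tau i y = tau i z0 & tau k y != tau k z0].
Proof.
move=> e0.
have [||||s [lam [s0 dlam lamE lam0]]] := @implicit_solution R V C^o r tau v z0 r0 (fun=> z0) (fun i c
    => single k c i) 0 1 r00 dtau tauv ltr01.
- by move=> c _; exact: differentiable_cst.
- by move=> i c _; apply: (@differentiable_single C^o k i id); exact: ex_diff.
- by [].
- by move=> i; rewrite /single; case: ifP.
pose y c := z0 + \sum_j lam j c *: v j.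
have dy : differentiable y 0.
  apply: differentiable_comb => [|j]; first exact: differentiable_cst.
  by apply: dlam; rewrite subrr nrm0.
have y0 : y 0 = z0.
  rewrite /y big1 ?addr0 // => j _; rewrite lam0 ?scale0r ?subrr ?nrm0 //.
  by move=> i; rewrite /single; case: ifP.
have /continuous_nrm /(_ e e0) [d d0 dP] := differentiable_continuous dy.
pose c : C^o := toC (Num.min s d / 2).
have m0 : 0 < Num.min s d by rewrite lt_min s0.
have nc : cabs (c - 0) < Num.min s d.
  by rewrite subr0 cabs_toC gtr0_norm; lra.
move: nc; rewrite lt_min => /andP[cs cd].
exists (y c); split.
- by rewrite -y0; exact: dP.
- by move=> i ik; rewrite (lamE _ cs) /single (negbTE ik) addr0.
- rewrite (lamE _ cs) /single eqxx -subr_eq0 addrAC subrr add0r.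
  by apply/eqP => c0; have := congr1 (@ReC R) c0; rewrite /= => /eqP; rewrite gt_eqF //; lra.
Qed.

(** Let [Y (z, c)] be [z] moved so that [tau k] grows by [c] and the other coordinates stay. In
    [V * C^o] the divisor is the linear function [c], and moving along [(0, 1)] reaches [c = 0],
    where [Y (z, 0) = z]; so Hadamard division gives [f (Y (z, c)) - f z = c * G (z, c)]. Put
    [c = - tau k z]. *)
Lemma local_retraction (k : 'I_r) (f : V -> C^o) : tau k z0 = 0 -> hol_ball f z0 r0 ->
  exists s (rho : V -> V) (b : V -> C^o), [/\ 0 < s <= r0, hol_ball rho z0 s, hol_ball b z0 s &
    forall z, nrm (z - z0) < s -> [/\ nrm (rho z - z0) < r0, tau k (rho z) = 0,
      forall i, i != k -> tau i (rho z) = tau i z &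
      f z = f (rho z) + tau k z * b z]].
Proof.
move=> tk df.
pose E : normedModType C := (V * C^o)%type.
have [||||s [lam [s0 dlam lamE lam0]]] := @implicit_solution R V E r tau v z0 r0 fst (fun i e => single
    k e.2 i) (z0, 0) r0 r00 dtau tauv r00.
- by move=> e _; exact: differentiable_fst.
- by move=> i e _; apply: (@differentiable_single E k i snd); exact: differentiable_snd.
- by [].
- by move=> i; rewrite /single; case: ifP.
pose Y (e : E) := e.1 + \sum_j lam j e *: v j.
have dY : hol_ball Y (z0, 0) s.
  move=> e es; apply: differentiable_comb => [|j]; first exact: differentiable_fst.
  exact: dlam.
have Y0 z : nrm ((z, 0) - (z0, 0) : E) < s -> Y (z, 0) = z.
  move=> zs; rewrite /Y big1 ?addr0 // => j _; rewrite lam0 ?scale0r //.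
  by move=> i; rewrite /single; case: ifP.
have ee : nrm ((z0, 0) - (z0, 0) : E) < s by rewrite subrr nrm0.
have /continuous_nrm /(_ _ r00) [d d0 dP] := differentiable_continuous (dY _ ee).
rewrite Y0 // in dP.
pose q := Num.min s d.
have q0 : 0 < q by rewrite lt_min s0.
have dF : hol_ball (f \o Y) (z0, 0) q.
  move=> e eq; have [es ed] : nrm (e - (z0, 0)) < s /\ nrm (e - (z0, 0)) < d by apply/andP; rewrite -lt_min.
  apply: differentiable_comp; first exact: dY.
  by apply: df; apply: dP.
have [||q' [G [q'0 dG GE]]] := @hadamard_division R E (f \o Y) snd (z0, 0) (0, 1) q q0 dF.
- by move=> e _; exact: differentiable_snd.
- by [].
pose p := Num.min q q'.
have p0 : 0 < p by rewrite lt_min q0.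
have dtk0 : differentiable (tau k) z0 by apply: dtau; rewrite subrr nrm0.
have /continuous_nrm /(_ _ p0) [d1 d10 d1P] := differentiable_continuous dtk0.
rewrite tk in d1P.
pose g z : C^o := - tau k z.
pose s1 := Num.min (Num.min d1 p) r0.
have s1P (x : R) : x < s1 -> [/\ x < d1, x < p & x < r0].
  by rewrite /s1 !lt_min => /andP[/andP[? ?] ?].
have pP (x : R) : x < p -> x < q /\ x < q' by rewrite /p lt_min => /andP[].
have qP (x : R) : x < q -> x < s /\ x < d by rewrite /q lt_min => /andP[].
have near z : nrm (z - z0) < s1 -> [/\ nrm ((z, g z) - (z0, 0) : E) < q, nrm ((z, g z) - (z0, 0) : E) < q',
     nrm (z - z0) < r0 & nrm ((z, 0) - (z0, 0) : E) < s].
  move=> /s1P[zd1 z2 z3]; have z1 := d1P z zd1.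
  have lp : nrm ((z, g z) - (z0, 0) : E) < p.
    have -> : (z, g z) - (z0, 0) = (z - z0, g z - 0) :> E by [].
    by rewrite nrm_pair gt_max subr0 /g nrmN; apply/andP; split => //; move: z1; rewrite subr0.
  have ls : nrm ((z, 0) - (z0, 0) : E) < s.
    have -> : (z, 0) - (z0, 0) = (z - z0, 0 - 0) :> E by [].
    by rewrite nrm_pair gt_max subr0 nrm0 s0 andbT; have [/qP[]] := pP _ z2.
  by have [] := pP _ lp.
exists s1, (fun z => Y (z, g z)), (fun z => G (z, g z)); split.
- have dp : 0 < Num.min d1 p by rewrite lt_min d10.
  by rewrite /s1 lt_min dp r00 ge_min lexx orbT.
- move=> z /near[z1 z2 z3 _]; apply: differentiable_graph.
    by apply: differentiableN; exact: dtau.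
  by apply: dY; have [] := qP _ z1.
- move=> z /near[z1 z2 z3 _]; apply: differentiable_graph; last exact: dG.
  by apply: differentiableN; exact: dtau.
move=> z /near[z1 z2 z3 z4]; have [zs zd] := qP _ z1; split.
- exact: dP.
- by rewrite /Y (lamE _ zs) /single eqxx /= subrr.
- by move=> i ik; rewrite /Y (lamE _ zs) /single (negbTE ik) addr0.
have := GE _ z2.
have -> : (z, g z) - (z, g z).2 *: ((0, 1) : E) = (z, 0).
  rewrite -[LHS]/((z - g z *: 0, g z - g z * 1) : E); congr (_, _); first by rewrite scaler0 subr0.
  by rewrite mulr1 subrr.
move=> fE; have {}fE : f (Y (z, g z)) - f z = (- tau k z) * G (z, g z).
  by move: fE; rewrite -[(f \o Y) (z, 0)]/(f (Y (z, 0))) (Y0 _ z4).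
have -> : f z = f (Y (z, g z)) - (f (Y (z, g z)) - f z) by rewrite subKr.
by rewrite fE mulNr opprK.
Qed.

End Chart.
End LocalSplit.

(** * Cech cohomology and refinements *)

Lemma open_forall (T : topologicalType) (I : finType) (F : I -> set T) :
  (forall i, open (F i)) -> open [set x | forall i, F i x].
Proof.
move=> oF; rewrite openE => x Fx.
by apply: filter_forall => i; apply: open_nbhs_nbhs.
Qed.

Lemma lift_lift q (k : 'I_q.+3) (l : 'I_q.+2) (m : 'I_q.+1) : (l < k)%N ->
  lift k (lift l m) = lift (inord l : 'I_q.+3) (lift (inord k.-1 : 'I_q.+2) m).
Proof.
move=> lk; apply: val_inj; rewrite /= /bump !inordK; [|have := ltn_ord k; lia|have := ltn_ord l; lia].
lia.
Qed.

Section Cech.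
Variables (R : realType) (n : nat) (X : complexManifold R n) (L : lineBundle X).
Implicit Types (U : set X) (q : nat).

Lemma cech_diff_diff U (V : openCover U) q (b : precochain L V q) i x :
  cech_diff (cech_diff b) i x = 0.
Proof.
rewrite /cech_diff.
under eq_bigr => k _ do rewrite scaler_sumr.
rewrite pair_big /=.
pose F (p : 'I_q.+3 * 'I_q.+2) : L x := (-1) ^+ p.1 *: ((-1) ^+ p.2 *: b (((i \o lift p.1) \o lift p.2)) x).
rewrite -/F (bigID (fun p : 'I_q.+3 * 'I_q.+2 => (p.2 < p.1)%N)) /=.
(* A pair [k <= l] goes to [(l.+1, k)]: the same two vertices are omitted in the other order, with
   the opposite sign. *)
pose h (p : 'I_q.+3 * 'I_q.+2) : 'I_q.+3 * 'I_q.+2 := (inord p.2.+1, inord p.1).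
pose h' (p : 'I_q.+3 * 'I_q.+2) : 'I_q.+3 * 'I_q.+2 := (inord p.2, inord p.1.-1).
rewrite (reindex_onto h h') /=; last first.
  move=> [k l] /= lk; rewrite /h /h' /=.
  have kl := ltn_ord k; have ll := ltn_ord l.
  by congr (_, _); apply: val_inj; rewrite /= !inordK; lia.
have cond p : ((h p).2 < (h p).1)%N && (h' (h p) == p) = ~~ (p.2 < p.1)%N.
  case: p => k l; rewrite /h /h' /=; have kl := ltn_ord k; have ll := ltn_ord l.
  rewrite (@inordK q.+2 l.+1) //= -leqNgt.
  case: (leqP k l) => [kl'|lk].
    have e3 : (inord k : 'I_q.+2) = k :> nat by rewrite inordK //; lia.
    rewrite e3 ltnS kl' /=; apply/eqP; congr (_, _); apply: val_inj => /=; rewrite inordK //; lia.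
  apply/negP => /andP[h1 /eqP[h2 _]].
  have := congr1 (@nat_of_ord _) h2; rewrite /= inordK; last by have := ltn_ord (inord k : 'I_q.+2); lia.
  move=> h3; lia.
rewrite (eq_bigl _ _ cond) -big_split /= big1 // => -[k l] /= kl.
rewrite -leqNgt in kl; rewrite /F /h /=.
have kk := ltn_ord k; have ll := ltn_ord l.
have e1 : (inord l.+1 : 'I_q.+3) = l.+1 :> nat by rewrite inordK.
have e2 : (inord k : 'I_q.+2) = k :> nat by rewrite inordK //; lia.
rewrite e1 e2.
have -> : (i \o lift (inord l.+1)) \o lift (inord k) = (i \o lift k) \o lift l.
  apply/funext => m /=; congr (i _); rewrite lift_lift; last by rewrite e1 e2 ltnS.
  rewrite e1 e2 /=; congr (lift _ (lift _ _)); apply: val_inj; rewrite /= inordK //; lia.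
by rewrite exprS mulN1r scaleNr !scalerA [in X in - X + _]mulrC addNr.
Qed.

Lemma cover_ex U (V : openCover U) x : U x -> exists i, oc_set V i x.
Proof.
move=> Ux; have [i _ ix] : (\bigcup_i oc_set V i) x by rewrite oc_cover.
by exists i.
Qed.

Lemma simplex_set_open U (V : openCover U) q (i : simplex V q) : open (simplex_set i).
Proof.
rewrite (_ : simplex_set i = [set x | forall k, oc_set V (i k) x]).
  by apply: open_forall => k; exact: oc_open.
by apply/seteqP; split => x /= H k; [exact: H | move=> _; exact: H].
Qed.

(** A subsheaf is encoded by a predicate [H x s] at points, so that restriction to a smaller set
    needs no operation on sections. *)
Definition section_on (H : X -> lsection L -> Prop) (D : set X) (s : lsection L) := forall x, D x -> H x s.

Definition cochain_in (H : X -> lsection L -> Prop) U (V : openCover U) q (c : precochain L V q) :=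
  forall i, section_on H (simplex_set i) (c i).

Definition acyclic (H : X -> lsection L -> Prop) U :=
  forall q (V : openCover U) (c : precochain L V q.+1),
    cochain_in H c -> cochain_eq (cech_diff c) (cochain0 L V q.+2) ->
    exists (T : openCover U) (rho : oc_idx T -> oc_idx V) (b : precochain L T q),
      [/\ refining rho, cochain_in H b & cochain_eq (cochain_pullback rho c) (cech_diff b)].

Lemma refining_simplex U (V T : openCover U) (rho : oc_idx T -> oc_idx V) q (j : simplex T q) :
  refining rho -> simplex_set j `<=` simplex_set (rho \o j).
Proof. by move=> rP x jx k _; apply: rP; exact: jx. Qed.

Lemma refining_comp U (V T T' : openCover U) (rho : oc_idx T -> oc_idx V) (rho' : oc_idx T' -> oc_idx T) :
  refining rho -> refining rho' -> refining (rho \o rho').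
Proof. by move=> rP rP' j x jx; apply: rP; exact: rP'. Qed.

Lemma face_simplex U (V : openCover U) q (i : simplex V q.+1) k :
  simplex_set i `<=` simplex_set (i \o lift k).
Proof. by move=> x ix l _; exact: ix. Qed.

Section Refine.
Hypothesis regX : @regular_space X.

(* The cover is refined by sets W_x whose level lev x is the rank of a basic
   open set around x.  If W_x0, ..., W_xq meet, let x be the x_k of largest
   level: the conditions imposed on W_x involve only the finitely many indices
   below lev x, so no local finiteness is needed. *)
Lemma refine_local U (V : openCover U) q (P : simplex V q -> set X -> Prop) :
  (forall i N N', P i N -> N' `<=` N -> P i N') ->
  (forall i, P i set0) ->
  (forall i x, simplex_set i x -> exists N, [/\ open N, N x & P i N]) ->
  exists (T : openCover U) (rho : oc_idx T -> oc_idx V),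
    refining rho /\ forall j : simplex T q, P (rho \o j) (simplex_set j).
Proof.
move=> Psub P0 Ploc.
have [B /countable_injP[g gB] [oB basB]] := @cm_second_countable _ _ X.
have /choice[e eP] : forall m : nat, exists b' : set X, forall b, B b -> g b = m -> b' = b.
  move=> m; have [[b [Bb gb]]|nb] := pselect (exists b, B b /\ g b = m).
    by exists b => b2 Bb2 gb2; apply: gB; rewrite ?inE // gb.
  by exists set0 => b Bb gb; exfalso; apply: nb; exists b.
pose good m i := closure (e m) `<=` oc_set V i.
(* The index depends only on the rank [m], so bounded ranks leave finitely many simplices to
   consider. *)
have /choice[I IP] : forall m : nat, exists o : option (oc_idx V),
    (forall i, o = Some i -> good m i) /\ ((exists i, good m i) -> exists i, o = Some i).
  move=> m; have [[i gi]|ng] := pselect (exists i, good m i).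
    by exists (Some i); split => [j [<-]|_] //; exists i.
  by exists None.
have lev_ex : forall x : {x | U x}, exists m : nat * oc_idx V,
   [/\ open (e m.1), e m.1 (proj1_sig x) & I m.1 = Some m.2].
  move=> [x Ux]; have [i ix] := cover_ex V Ux.
  have Nx : nbhs x (oc_set V i) by apply: open_nbhs_nbhs; split => //; exact: oc_open.
  have [M Mx clM] := regX Nx.
  have [b [/= Bb bx] bM] := basB x M Mx.
  have eb : e (g b) = b by apply: eP.
  have [|j Ij] := (IP (g b)).2.
    by exists i; rewrite /good eb; apply: subset_trans clM; exact: closure_subset.
  by exists (g b, j); rewrite /= eb; split => //; exact: oB.
have [lr lrP] := choice lev_ex.
pose lev x := (lr x).1; pose rho x := (lr x).2.
have N_ex : forall (x : {x | U x}) (sig : {ffun 'I_q.+1 -> 'I_(lev x).+1}), exists N : set X,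
    nbhs (proj1_sig x) N /\ forall tau : simplex V q, (forall k, I (sig k) = Some (tau k)) ->
      simplex_set tau (proj1_sig x) -> P tau N.
  move=> x sig; have [[tau [tI tx]]|nt] := pselect (exists tau : simplex V q,
      (forall k, I (sig k) = Some (tau k)) /\ simplex_set tau (proj1_sig x)); last first.
    by exists setT; split; [exact: filterT | move=> tau tI tx; exfalso; apply: nt; exists tau].
  have [N [oN Nx PN]] := Ploc _ _ tx.
  exists N; split; first exact: open_nbhs_nbhs.
  move=> tau' tI' _; suff -> : tau' = tau by [].
  by apply/funext => k; have := tI' k; rewrite tI => -[].
have /choice[NN NNP] : forall p : {x : {x | U x} & {ffun 'I_q.+1 -> 'I_(lev x).+1}}, exists N : set X,
    nbhs (proj1_sig (projT1 p)) N /\ forall tau : simplex V q, (forall k, I (projT2 p k) = Some (tau k)) ->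
      simplex_set tau (proj1_sig (projT1 p)) -> P tau N.
  by move=> [x sig]; exact: N_ex.
(* If [W x] meets a set [W x'] of no larger level, then [x] lies in [oc_set V (rho x')]: otherwise
   [W x] would avoid the basic set containing [W x']. Such avoidance is possible because the closure
   of [e m] lies in the chosen cover set. *)
have M_ex : forall (x : {x | U x}) (m : 'I_(lev x).+1), nbhs (proj1_sig x)
   [set y | forall i, I m = Some i -> ~ oc_set V i (proj1_sig x) -> ~ e m y].
  move=> x m; case Im : (I m) => [i|]; last by apply: filterE => y i.
  have [ix|nix] := pselect (oc_set V i (proj1_sig x)).
    by apply: filterE => y j [<-] /(_ ix).
  have ncl : ~ closure (e m) (proj1_sig x) by move=> /((IP m).1 i Im).
  have : nbhs (proj1_sig x) (~` closure (e m)).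
    by apply: open_nbhs_nbhs; split => //; exact/closed_openC/closed_closure.
  by apply: filterS => y ny j _ _ ey; apply: ny; exact: subset_closure.
pose W0 (x : {x | U x}) : set X := [set y | e (lev x) y] `&`
  [set y | forall m : 'I_(lev x).+1, forall i, I m = Some i -> ~ oc_set V i (proj1_sig x) -> ~ e m y] `&`
  [set y | forall sig, NN (existT _ x sig) y].
have W0x x : nbhs (proj1_sig x) (W0 x).
  apply: filterI; [apply: filterI|].
  - by have [oe ex _] := lrP x; apply: open_nbhs_nbhs.
  - by apply: filter_forall => m; exact: M_ex.
  - by apply: filter_forall => sig; exact: (NNP (existT _ x sig)).1.
pose W x := (W0 x)°.
have WW0 x : W x `<=` W0 x by exact: interior_subset.
have We x : W x `<=` e (lev x) by move=> y /WW0 [[]].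
have Wrho x : W x `<=` oc_set V (rho x).
  move=> y /We ey; have [_ _ Ix] := lrP x.
  by apply: ((IP _).1 _ Ix); exact: subset_closure.
have Wcover : \bigcup_x W x = U.
  apply/seteqP; split => [y [x _ /Wrho ry]|x Ux].
    by have := oc_cover V; move=> <-; exists (rho x).
  by exists (exist _ x Ux) => //; exact: (W0x (exist _ x Ux)).
pose T : openCover U := @OpenCover _ _ _ U {x | U x} W (fun x => @open_interior _ (W0 x)) Wcover.
exists T, rho; split; first exact: Wrho.
move=> j; have [[y jy]|nj] := pselect (exists y, simplex_set j y); last first.
  suff -> : simplex_set j = set0 by exact: P0.
  by apply/seteqP; split => // y jy; exfalso; apply: nj; exists y.
pose m := [arg max_(k > ord0 : 'I_q.+1) lev (j k)].
have mP k : (lev (j k) <= lev (j m))%N.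
  by rewrite /m; case: arg_maxnP => // m' _ mm; exact: mm.
pose sig : {ffun 'I_q.+1 -> 'I_(lev (j m)).+1} := [ffun k => inord (lev (j k))].
have sigE k : sig k = lev (j k) :> nat by rewrite ffunE inordK // ltnS.
have Isig k : I (sig k) = Some (rho (j k)) by rewrite sigE; have [_ _] := lrP (j k).
have jm : simplex_set (rho \o j) (proj1_sig (j m)).
  move=> k _; apply: contrapT => nk.
  have [[_ Wm] _] := WW0 _ _ (jy m Logic.I).
  have km : (lev (j k) < (lev (j m)).+1)%N by rewrite ltnS.
  have [_ _ Ik] := lrP (j k).
  by apply: (Wm (Ordinal km) (rho (j k)) Ik nk); apply: We; exact: jy.
apply: (Psub _ (NN (existT _ (j m) sig))).
  exact: (NNP (existT _ (j m) sig)).2.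
by move=> z jz; have [_ Wz] := WW0 _ _ (jz m Logic.I); exact: Wz.
Qed.

End Refine.

Lemma cech_diff_pullback U (V T : openCover U) (rho : oc_idx T -> oc_idx V) q (c : precochain L V q) :
  cech_diff (cochain_pullback rho c) = cochain_pullback rho (cech_diff c).
Proof. by []. Qed.

Definition combine U (V : openCover U) q (t : X -> Cplx R) (a b : precochain L V q) : precochain L V q :=
  fun i x => a i x + t x *: b i x.

Lemma cech_diff_combine U (V : openCover U) q t (a b : precochain L V q) i x :
  cech_diff (combine t a b) i x = cech_diff a i x + t x *: cech_diff b i x.
Proof.
rewrite /cech_diff /combine scaler_sumr -big_split /=; apply: eq_bigr => k _.
by rewrite scalerDr !scalerA mulrC.
Qed.

Lemma cech_diff_eq U (V : openCover U) q (a b : precochain L V q) :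
  cochain_eq a b -> cochain_eq (cech_diff a) (cech_diff b).
Proof.
move=> ab i x ix; apply: eq_bigr => k _; congr (_ *: _); apply: ab.
exact: face_simplex.
Qed.

Record germ_closed (H : X -> lsection L -> Prop) : Prop := GermClosed {
  germ_local : forall x s s' N, open N -> N x -> (forall y, N y -> s y = s' y) -> H x s -> H x s' ;
  germ0 : forall x, H x (fun=> 0) ;
  germD : forall x s s', H x s -> H x s' -> H x (fun y => s y + s' y) ;
  germZ : forall x (a : Cplx R) s, H x s -> H x (fun y => a *: s y) }.

Lemma cech_diff_in H U (V : openCover U) q (c : precochain L V q) :
  germ_closed H -> cochain_in H c -> cochain_in H (cech_diff c).
Proof.
move=> HH cc i x ix; rewrite /cech_diff.
have HS (r : seq 'I_q.+2) : H x (fun y => \sum_(k <- r) (-1) ^+ k *: c (i \o lift k) y).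
  elim: r => [|k r IH].
    rewrite (_ : (fun _ => _) = (fun=> 0)); first exact: germ0.
    by apply/functional_extensionality_dep => y; rewrite big_nil.
  rewrite (_ : (fun _ => _) = (fun y => (-1) ^+ k *: c (i \o lift k) y + \sum_(k <- r) (-1) ^+ k *: c
      (i \o lift k) y)).
    by apply: germD => //; apply: germZ => //; apply: cc; exact: face_simplex.
  by apply/functional_extensionality_dep => y; rewrite big_cons.
exact: HS.
Qed.

Lemma germ_ext H x s s' : germ_closed H -> (forall y, s y = s' y) -> H x s -> H x s'.
Proof. by move=> HH ss; apply: (germ_local HH openT). Qed.

Lemma cech_diffB U (V : openCover U) q (a b : precochain L V q) i x :
  cech_diff (cochainB a b) i x = cech_diff a i x - cech_diff b i x.
Proof.
rewrite /cech_diff /cochainB -sumrB; apply: eq_bigr => k _.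
by rewrite scalerBr.
Qed.

Lemma germB H x s s' : germ_closed H -> H x s -> H x s' -> H x (fun y => s y - s' y).
Proof.
move=> HH Hs Hs'; apply: (germ_ext HH _ (germD HH Hs (germZ HH (-1) Hs'))) => y.
by rewrite scaleN1r.
Qed.

Lemma pullback_in H U (V T : openCover U) (rho : oc_idx T -> oc_idx V) q (c : precochain L V q) :
  refining rho -> cochain_in H c -> cochain_in H (cochain_pullback rho c).
Proof. by move=> rP cc i x ix; apply: cc; exact: refining_simplex ix. Qed.

Lemma pullback_eq U (V T : openCover U) (rho : oc_idx T -> oc_idx V) q (c d : precochain L V q) :
  refining rho -> cochain_eq c d -> cochain_eq (cochain_pullback rho c) (cochain_pullback rho d).
Proof. by move=> rP cd i x ix; apply: cd; exact: refining_simplex ix. Qed.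

Lemma glue_0cocycle H U (T : openCover U) (a : precochain L T 0) : germ_closed H ->
  cochain_in H a -> cochain_eq (cech_diff a) (cochain0 L T 1) ->
  exists2 s, section_on H U s & forall i x, simplex_set i x -> s x = a i x.
Proof.
move=> HH aH da.
have agree i j x : oc_set T i x -> oc_set T j x -> a (fun=> i) x = a (fun=> j) x.
  move=> ix jx; pose k : simplex T 1 := fun m => if m == ord0 then j else i.
  have kx : simplex_set k x by move=> m _; rewrite /k; case: (m == ord0).
  have := da k x kx; rewrite /cech_diff big_ord_recr big_ord1 /= expr0 scale1r expr1 scaleN1r => /eqP.
  rewrite subr_eq0 => /eqP; congr (a _ x = a _ x); apply/funext => m /=; rewrite /k ord1 //.
pose s : lsection L := fun x =>
  if pselect (exists i, oc_set T i x) is left h then a (fun=> projT1 (cid h)) x else 0.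
have sP i x : oc_set T i x -> s x = a (fun=> i) x.
  move=> ix; rewrite /s; case: pselect => [h|[]]; last by exists i.
  exact: agree (projT2 (cid h)) ix.
exists s => [x Ux|i x ix]; last first.
  rewrite (sP (i ord0) x (ix ord0 Logic.I)); congr (a _ x).
  by apply/funext => m; rewrite [m]ord1.
have [i ix] := cover_ex T Ux.
have ei : forall y, oc_set T i y -> a (fun=> i) y = s y by move=> y iy; rewrite (sP i).
have ia : H x (a (fun=> i)) by apply: (aH (fun=> i)) => m _; exact: ix.
have oTi : open (oc_set T i) by exact: oc_open.
exact: (germ_local HH oTi ix ei ia).
Qed.

(** * Cohomology of the short exact sequence *)

Section ExactSequence.
Variables (K O J : X -> lsection L -> Prop) (t : X -> Cplx R).
Hypothesis regX : @regular_space X.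
Hypotheses (HK : germ_closed K) (HO : germ_closed O).
Hypothesis KO : forall x s, K x s -> O x s.
Hypothesis KM : forall x s, K x s -> K x (fun y => t y *: s y).
Hypothesis KOJ : forall x a b, K x a -> O x b -> J x (fun y => a y + t y *: b y).
Hypothesis J_split : forall x N s, open N -> N x -> section_on J N s -> exists N' a b,
  [/\ open N', N' x, section_on K N' a, section_on O N' b & forall y, N' y -> s y = a y + t y *: b y].
Hypothesis t_regular : forall x N b, open N -> N x -> section_on O N b ->
  section_on K N (fun y => t y *: b y) -> K x b.

(* The kernel of K + O -> J, (a, b) |-> a + t b, is K again, embedded by
   e |-> (- t e, e): writing c = a + t b locally, the coboundary of b lies in
   K and is corrected by a cochain e of K. *)
Lemma cocycle_split U q (V : openCover U) (c : precochain L V q) : acyclic K U ->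
  cochain_in J c -> cochain_eq (cech_diff c) (cochain0 L V q.+1) ->
  exists (T : openCover U) (rho : oc_idx T -> oc_idx V) (a b : precochain L T q),
    [/\ refining rho,
       cochain_in K a /\ cochain_eq (cech_diff a) (cochain0 L T q.+1),
       cochain_in O b /\ cochain_eq (cech_diff b) (cochain0 L T q.+1) &
       cochain_eq (cochain_pullback rho c) (combine t a b)].
Proof.
move=> acK cJ dc.
pose P (i : simplex V q) N := exists p : lsection L * lsection L,
  [/\ section_on K N p.1, section_on O N p.2 & forall y, N y -> c i y = p.1 y + t y *: p.2 y].
have [||| T1 [rho1 [r1 PT1]]] := @refine_local regX U V q P.
- move=> i N N' [p [p1 p2 p3]] NN'; exists p.
  by split => y /NN' Ny; [exact: p1 | exact: p2 | exact: p3].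
- by move=> i; exists (fun=> 0, fun=> 0); split.
- move=> i x ix; have [N [a [b [oN Nx Ka Ob cE]]]] := J_split (simplex_set_open i) ix (cJ i).
  by exists N; split => //; exists (a, b).
have [ab abP] := choice PT1.
pose a1 : precochain L T1 q := fun j => (ab j).1.
pose b1 : precochain L T1 q := fun j => (ab j).2.
have a1K : cochain_in K a1 by move=> j; have [] := abP j.
have b1O : cochain_in O b1 by move=> j; have [] := abP j.
have cE : cochain_eq (cochain_pullback rho1 c) (combine t a1 b1).
  by move=> j x jx; have [_ _] := abP j; apply.
have dab i x : simplex_set i x -> cech_diff a1 i x + t x *: cech_diff b1 i x = 0.
  move=> ix; rewrite -cech_diff_combine -(cech_diff_eq cE ix) cech_diff_pullback.
  by apply: dc; exact: refining_simplex ix.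
(* As [c] is a cocycle, [t] times the coboundary of [b1] is minus that of [a1], hence in [K];
   [t_regular] divides by [t]. *)
have db1K : cochain_in K (cech_diff b1).
  move=> i x ix; apply: (t_regular (simplex_set_open i) ix).
    exact: cech_diff_in.
  move=> y iy; apply: (germ_local HK (simplex_set_open i) iy) (germZ HK (-1) (cech_diff_in HK a1K iy)).
  by move=> z iz; rewrite scaleN1r; apply/eqP; rewrite eqr_oppLR -addr_eq0; apply/eqP; exact: dab.
(* This cocycle has degree [q.+1], so acyclicity applies even for [q = 0]. The corrected pair is
   [a1 + t e] and [b1 - e]. *)
have [|T2 [rho2 [e [r2 eK eE]]]] := acK q T1 (cech_diff b1) db1K.
  by move=> i x _; exact: cech_diff_diff.
exists T2, (rho1 \o rho2), (combine t (cochain_pullback rho2 a1) e), (cochainB (cochain_pullback rho2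
    b1) e).
have pa1 := pullback_in r2 a1K; have pb1 := pullback_in r2 b1O.
split.
- exact: refining_comp.
- split.
    by move=> i x ix; apply: (germD HK); [exact: pa1 | apply: KM; exact: eK].
  move=> i x ix; rewrite cech_diff_combine -(eE i x ix) cech_diff_pullback.
  by apply: dab; exact: refining_simplex ix.
- split.
    by move=> i x ix; apply: (germB HO); [exact: pb1 | apply: KO; exact: eK].
  by move=> i x ix; rewrite cech_diffB cech_diff_pullback (eE i x ix) subrr.
- move=> i x ix; rewrite /combine /cochainB -addrA -scalerDr [e i x + _]addrC subrK.
  by apply: cE; exact: refining_simplex ix.
Qed.

Lemma acyclic_extension U : acyclic K U -> acyclic O U -> acyclic J U.
Proof.
move=> acK acO q V c cJ dc.
have [T [rho [a [b [r1 [aK da] [bO db] cE]]]]] := cocycle_split acK cJ dc.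
have [T2 [rho2 [a' [r2 a'K aE]]]] := acK q T a aK da.
have [|T3 [rho3 [b' [r3 b'O bE]]]] := acO q T2 (cochain_pullback rho2 b) (pullback_in r2 bO).
  exact: (pullback_eq r2 db).
exists T3, (rho \o (rho2 \o rho3)), (combine t (cochain_pullback rho3 a') b'); split.
- by apply: refining_comp => //; exact: refining_comp.
- by move=> i x ix; apply: KOJ; [exact: (pullback_in r3 a'K) | exact: b'O].
- move=> i x ix; rewrite cech_diff_combine -(bE i x ix) cech_diff_pullback.
  rewrite -[cochain_pullback rho3 _ i x]/(cech_diff a' (rho3 \o i) x).
  rewrite -(aE _ _ (refining_simplex r3 ix)).
  exact: (cE _ _ (refining_simplex r2 (refining_simplex r3 ix))).
Qed.

(** A section is a 0-cocycle on the cover by [U] alone, and the two 0-cocycles into which it splits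
    glue to sections. *)
Lemma section_extension U s : open U -> acyclic K U -> section_on J U s ->
  exists a b, [/\ section_on K U a, section_on O U b & forall x, U x -> s x = a x + t x *: b x].
Proof.
move=> oU acK sJ.
have cov : \bigcup_(_ : unit) U = U by apply/seteqP; split => [x [_ _ Ux]|x Ux] //; exists tt.
pose V : openCover U := @OpenCover _ _ _ U unit (fun=> U) (fun=> oU) cov.
pose c : precochain L V 0 := fun=> s.
have [||T [rho [a [b [r1 [aK da] [bO db] cE]]]]] := cocycle_split acK (c := c).
- by move=> i x /(_ ord0 Logic.I); exact: sJ.
- move=> i x _; rewrite /cech_diff /c big_ord_recr big_ord1 /= expr0 scale1r expr1 scaleN1r.
  by rewrite subrr.
have [a' a'K aE] := glue_0cocycle HK aK da.
have [b' b'O bE] := glue_0cocycle HO bO db.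
exists a', b'; split => // x Ux; have [i ix] := cover_ex T Ux.
have ix' : simplex_set ((fun=> i) : simplex T 0) x by move=> m _; exact: ix.
by rewrite (aE _ _ ix') (bE _ _ ix'); exact: (cE _ _ ix').
Qed.

End ExactSequence.

End Cech.

(** * Ideal sheaves on the manifold *)

Lemma diff_coord (K : numFieldType) (V : normedModType K) m n (f : V -> 'M[K]_(m, n)) (x v : V) i j :
  differentiable f x ->
  differentiable (fun z => f z i j : K^o) x /\ 'd (fun z => f z i j : K^o) x v = 'd f x v i j.
Proof.
move=> df; pose c : 'M[K]_(m, n) -> K^o := fun N => N i j.
have lc : linear c by move=> a A B; rewrite /c !mxE.
pose c' : {linear 'M[K]_(m, n) -> K^o} := HB.pack c (GRing.isLinear.Build _ _ _ _ c lc).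
have cc : continuous c' by exact: coord_continuous.
have dc := linear_differentiable (f x) cc.
split; first exact: (differentiable_comp df dc).
by rewrite -[LHS]/('d (c' \o f) x v) (diff_comp df dc) (diff_lin _ cc).
Qed.

Lemma differentiable_comp_at (K : numFieldType) (U V W : normedModType K) (f : U -> V) (g : V -> W) x y :
  f x = y -> differentiable f x -> differentiable g y -> differentiable (g \o f) x.
Proof. by move=> <-; exact: differentiable_comp. Qed.

Section Manifold.
Variables (R : realType) (n : nat) (X : complexManifold R n).
Local Notation C := (Cplx R).
Local Notation cabs := (@nrm R C^o).
Local Notation Cn := 'rV[C]_n.

Lemma compact_square (z0 : C) (e : R) :
  compact [set w : C | `|ReC w - ReC z0| <= e /\ `|ImC w - ImC z0| <= e].
Proof.
pose S (a : R) : set R := `[a - e, a + e]%classic.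
have -> : [set w : C | `|ReC w - ReC z0| <= e /\ `|ImC w - ImC z0| <= e]
   = (fun p : R * R => mkC p.1 p.2) @` (S (ReC z0) `*` S (ImC z0)).
  apply/seteqP; split => [w [/= wr wi]|_ [[a b] [/= aS bS] <-]].
    exists (ReC w, ImC w) => /=; last exact: mkCK.
    by split; rewrite /S /= in_itv /=; move: wr wi; rewrite !ler_norml; lra.
  by move: aS bS; rewrite /S /= !in_itv /= !ler_norml; lra.
apply: continuous_compact; last by apply: compact_setX; exact: segment_compact.
apply: continuous_subspaceT => p; apply/(@cvgrPdist_lt C C) => d d0.
have dE := @toC_ge0 R d (ltW d0); set d' := ReC d in dE.
have d'0 : 0 < d' by rewrite -toC_lt -dE.
have h0 : 0 < d' / 2 by lra.
exists (ball p.1 (d' / 2), ball p.2 (d' / 2)).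
  by split; apply: nbhsx_ballx.
move=> q [] /=; rewrite /ball /= => q1 q2.
rewrite dE [X in X < _](@nrmE R C^o) toC_lt.
apply: le_lt_trans (cabs_le _) _; rewrite ReCD ImCD ReCN ImCN /=; lra.
Qed.

Lemma chart_inv_continuous (c : chart R n X) x : chart_dom c x ->
  {for chart_map c x, continuous (chart_inv c)}.
Proof.
move=> cx; have := @chart_inv_cont _ _ _ c; rewrite continuous_open_subspace; last exact: chart_cod_open.
by apply; rewrite inE; exists x.
Qed.

Lemma chart_map_continuous (c : chart R n X) x : chart_dom c x ->
  {for x, continuous (chart_map c)}.
Proof.
move=> cx; have := @chart_map_cont _ _ _ c; rewrite continuous_open_subspace; last exact: chart_dom_open.
by apply; rewrite inE.
Qed.

Lemma chart_invK (c : chart R n X) x : chart_dom c x -> chart_inv c (chart_map c x) = x.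
Proof. by move=> cx; apply: chart_mapK; rewrite inE. Qed.

(** The inverse chart carries a closed cube to a compact neighbourhood, and a Hausdorff space is
    regular at a point having one. *)
Lemma manifold_regular : @regular_space X.
Proof.
move=> x; have [c _ cx] := cm_atlas_cover x.
set z0 := chart_map c x.
have /nbhs_ballP[e /= e0 eP] : nbhs z0 (chart_map c @` chart_dom c).
  by apply: open_nbhs_nbhs; split; [exact: chart_cod_open | exists x].
have eE := @toC_ge0 R e (ltW e0); set e' := ReC e in eE.
have e'0 : 0 < e' by rewrite -toC_lt -eE.
pose A (i : 'I_n) : set C := [set w : C | `|ReC w - ReC (z0 ord0 i)| <= e' / 4 /\ `|ImC w - ImC (z0
    ord0 i)| <= e' / 4].
pose K : set Cn := [set v | forall i, A i (v ord0 i)].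
have cK : compact K.
  by apply: (@rV_compact C n A) => i; exact: compact_square.
have Kcod : K `<=` chart_map c @` chart_dom c.
  move=> v Kv; apply: eP; split => // i j; rewrite ord1 -ball_normE /ball_ /=.
  rewrite eE [X in X < _](@nrmE R C^o) toC_lt nrmB.
  have [k1 k2] := Kv j.
  by apply: le_lt_trans (cabs_le _) _; rewrite ReCD ImCD ReCN ImCN; lra.
have cV : compact (chart_inv c @` K).
  apply: continuous_compact => //; apply: continuous_subspaceW Kcod _; exact: chart_inv_cont.
apply: (compact_regular (@cm_hausdorff R n X) cV).
have Kz : nbhs z0 K.
  apply/nbhs_ballP; exists (toC (e' / 4)); first by rewrite /= -toC0 toC_lt; lra.
  move=> v [_ vb] i; have := vb ord0 i; rewrite -ball_normE /ball_ /=.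
  rewrite [X in X < _](@nrmE R C^o) toC_lt nrmB => vi.
  split; apply: ltW; apply: le_lt_trans vi; first by rewrite -ReCN -ReCD ReC_le.
  by rewrite -ImCN -ImCD ImC_le.
have Dx : nbhs x (chart_dom c) by apply: open_nbhs_nbhs; split => //; exact: chart_dom_open.
have := chart_map_continuous cx Kz => Kx.
near=> y; exists (chart_map c y); first by near: y.
by rewrite chart_invK //; near: y.
Unshelve. all: by end_near. Qed.

Lemma chart_near (c : chart R n X) x (N : set X) : chart_dom c x -> nbhs x N ->
  exists2 d : R, 0 < d & forall z : Cn, nrm (z - chart_map c x) < d ->
    [/\ chart_dom c (chart_inv c z), N (chart_inv c z) & chart_map c (chart_inv c z) = z].
Proof.
move=> cx Nx; apply/nbhs_nrm.
have Nz : nbhs (chart_map c x) (chart_inv c @^-1` N).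
  by apply: chart_inv_continuous => //; rewrite chart_invK.
have Cz : nbhs (chart_map c x) (chart_map c @` chart_dom c).
  by apply: open_nbhs_nbhs; split; [exact: chart_cod_open | exists x].
apply: filterS (filterI Nz Cz) => z [Nz' [y cy yz]].
by move: Nz'; rewrite /preimage /= -yz chart_invK.
Qed.

Lemma chart_pull (c : chart R n X) x (d : R) : chart_dom c x -> 0 < d ->
  nbhs x [set y | chart_dom c y /\ nrm (chart_map c y - chart_map c x) < d].
Proof.
move=> cx d0; apply: filterI.
  by apply: open_nbhs_nbhs; split => //; exact: chart_dom_open.
by apply: (chart_map_continuous cx (t := [set z | nrm (z - chart_map c x) < d])); apply/nbhs_nrm; exists d.
Qed.

Definition holfun_at (W : normedModType C) (f : X -> W) (x : X) :=
  forall c, cm_atlas c -> chart_dom c x -> differentiable (f \o chart_inv c) (chart_map c x).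

Lemma holfun_at_chart (W : normedModType C) (f : X -> W) (x : X) c :
  cm_atlas c -> chart_dom c x -> differentiable (f \o chart_inv c) (chart_map c x) -> holfun_at f x.
Proof.
move=> ac cx df d ad dx.
have dcx := cm_atlas_compat ad ac dx cx.
have : differentiable ((f \o chart_inv c) \o (chart_map c \o chart_inv d)) (chart_map d x).
  have E : (chart_map c \o chart_inv d) (chart_map d x) = chart_map c x by rewrite /= chart_invK.
  exact: (differentiable_comp_at E dcx df).
apply: differentiable_near_eq.
have od : open (chart_dom c) by exact: chart_dom_open.
have [e e0 eP] := chart_near dx (open_nbhs_nbhs (conj od cx)).
by apply/nbhs_nrm; exists e => // z /eP[_ cz _] /=; rewrite chart_invK.
Qed.

Lemma holfun_at_near (W : normedModType C) (f g : X -> W) x N : open N -> N x ->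
  (forall y, N y -> f y = g y) -> holfun_at f x -> holfun_at g x.
Proof.
move=> oN Nx fg hf c ac cx; apply: differentiable_near_eq (hf c ac cx).
have [e e0 eP] := chart_near cx (open_nbhs_nbhs (conj oN Nx)).
by apply/nbhs_nrm; exists e => // z /eP[_ Nz _]; exact: fg.
Qed.

Lemma holfun_atM (f g : X -> C^o) x :
  holfun_at f x -> holfun_at g x -> holfun_at (fun y => f y * g y : C^o) x.
Proof. by move=> hf hg c ac cx; exact: (differentiableM (hf c ac cx) (hg c ac cx)). Qed.

Lemma holfun_atV (f : X -> C^o) x : f x != 0 -> holfun_at f x -> holfun_at (fun y => (f y)^-1 : C^o) x.
Proof.
move=> fx hf c ac cx; apply: (differentiableV (hf c ac cx)).
by rewrite /= chart_invK.
Qed.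

Section Bundle.
Variable L : lineBundle X.

(** Differentiability at [x] alone; holomorphy results once it is required at all points of an open
    set. *)
Definition holo_at (x : X) (s : lsection L) :=
  forall a, lb_dom a x -> holfun_at (fun y => lb_triv a y (s y)) x.

Lemma holomorphic_sectionP (U : set X) (s : lsection L) :
  holomorphic_section U s <-> section_on holo_at U s.
Proof.
split=> [hs x Ux a ax c ac cx|hs a c ac x [Ux ax] cx]; first exact: hs.
exact: hs.
Qed.

Lemma holo_at_triv (x : X) (s : lsection L) a : lb_dom a x ->
  holfun_at (fun y => lb_triv a y (s y)) x -> holo_at x s.
Proof.
move=> ax hs b bx; have [g hg gE] := lb_transition a b.
have oab : open (lb_dom a `&` lb_dom b) by apply: openI; exact: lb_dom_open.
have gx : holfun_at g x by move=> c ac cx; exact: hg.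
apply: (holfun_at_near oab (conj ax bx) _ (holfun_atM gx hs)).
by move=> y [ay b_y]; rewrite gE.
Qed.

Lemma germ_closed_holo : germ_closed holo_at.
Proof.
split=> [x s s' N oN Nx ss hs a ax|x a ax c ac cx|x s s' hs hs' a ax c ac cx|x k s hs a ax c ac cx].
- by apply: (holfun_at_near oN Nx _ (hs a ax)) => y /ss ->.
- rewrite (_ : _ \o _ = cst (0 : C^o)); first exact: differentiable_cst.
  by apply/funext => z /=; exact: linear0.
- rewrite (_ : _ \o _ = ((fun y => lb_triv a y (s y)) \o chart_inv c) + ((fun y => lb_triv a y (s' y))
    \o chart_inv c)).
    exact: (differentiableD (hs a ax c ac cx) (hs' a ax c ac cx)).
  by apply/funext => z /=; exact: linearD.
- rewrite (_ : _ \o _ = k *: ((fun y => lb_triv a y (s y)) \o chart_inv c)).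
    exact: (differentiableZ k (hs a ax c ac cx)).
  by apply/funext => z /=; exact: linearZ.
Qed.

Lemma holo_atM (u : X -> C^o) (s : lsection L) x :
  holfun_at u x -> holo_at x s -> holo_at x (fun y => u y *: s y).
Proof.
move=> hu hs a ax; apply: (holfun_at_near openT Logic.I _ (holfun_atM hu (hs a ax))).
by move=> y _; apply: esym; exact: linearZ.
Qed.

Lemma triv_inj a x (v w : L x) : lb_dom a x -> lb_triv a x v = lb_triv a x w -> v = w.
Proof. by move=> /(lb_triv_bij (a := a)) /bij_inj; apply. Qed.

Definition untriv a (f : X -> C^o) : lsection L := fun y =>
  if pselect (exists v : L y, lb_triv a y v = f y) is left h then projT1 (cid h) else 0.

Lemma untrivK a f y : lb_dom a y -> lb_triv a y (untriv a f y) = f y.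
Proof.
move=> ay; rewrite /untriv; case: pselect => [h|[]]; first exact: projT2 (cid h).
by have [g _ gK] := lb_triv_bij ay; exists (g (f y)); exact: gK.
Qed.

Lemma holo_at_untriv a (f : X -> C^o) x : lb_dom a x -> holfun_at f x -> holo_at x (untriv a f).
Proof.
move=> ax hf; have oa : open (lb_dom a) by exact: lb_dom_open.
apply: (holo_at_triv ax); apply: (holfun_at_near oa ax _ hf).
by move=> y ay; rewrite untrivK.
Qed.

(** * Sections vanishing on coordinate subspaces *)

Section Submersion.
Variables (r : nat) (t : X -> 'rV[C]_r).
Hypothesis ht : holomorphic_submersion t.

Definition coordinate (i : 'I_r) (y : X) : C^o := t y 0 i.

Lemma holfun_coordinate i x : holfun_at (coordinate i) x.
Proof.
by move=> c ac cx; exact: (@diff_coord _ _ _ _ _ _ 0 0 i (ht.1 c ac x Logic.I cx)).1.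
Qed.

(** Surjectivity of the differential provides the vectors required by the local lemmas as hypothesis
    [tauv]. *)
Lemma dual_frame c x : cm_atlas c -> chart_dom c x -> exists v : 'I_r -> Cn,
  forall i j, 'd (coordinate i \o chart_inv c) (chart_map c x) (v j) = (i == j)%:R.
Proof.
move=> ac cx; have surj := ht.2 c ac x cx.
have /choice[v vP] : forall j : 'I_r, exists v : Cn, 'd (t \o chart_inv c) (chart_map c x) v = delta_mx 0 j.
  by move=> j; have [v _ vE] := surj (delta_mx 0 j) Logic.I; exists v.
exists v => i j; have := @diff_coord _ _ _ _ _ _ (v j) 0 i (ht.1 c ac x Logic.I cx).
by move=> [_]; rewrite vP mxE eqxx.
Qed.

Definition vanishing (B : {set 'I_r}) (x : X) (s : lsection L) :=
  holo_at x s /\ ((forall i, i \in B -> t x 0 i = 0) -> s x = 0).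

Lemma germ_closed_vanishing B : germ_closed (vanishing B).
Proof.
have HO := germ_closed_holo.
split=> [x s s' N oN Nx ss [hs s0]|x|x s s' [hs s0] [hs' s'0]|x a s [hs s0]].
- by split; [exact: (germ_local HO oN Nx ss) | move=> /s0; rewrite ss].
- by split => //; exact: (germ0 HO).
- by split; [exact: (germD HO) | move=> tx; rewrite s0 // s'0 // addr0].
- by split; [exact: (germZ HO) | move=> tx; rewrite s0 // scaler0].
Qed.

(* The points with t_k != 0 are dense in the common zero set of B. *)
Lemma vanishing_regular (B : {set 'I_r}) k x N b : k \notin B -> open N -> N x ->
  section_on holo_at N b -> section_on (vanishing B) N (fun y => t y 0 k *: b y) -> vanishing B x b.
Proof.
move=> kB oN Nx hb tb; split; first exact: hb.
move=> tx; have [tk0|tk0] := eqVneq (t x 0 k) 0; last first.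
  have [_ /(_ tx) /eqP] := tb x Nx; rewrite scaler_eq0 (negbTE tk0) /=; exact: eqP.
have [c ac cx] := cm_atlas_cover x; have [a ax] := lb_dom_cover L x.
apply: contrapT => bx.
have [d1 d10 d1P] := chart_near cx (open_nbhs_nbhs (conj oN Nx)).
have oa : open (lb_dom a) by exact: lb_dom_open.
have [d2 d20 d2P] := chart_near cx (open_nbhs_nbhs (conj oa ax)).
have df := hb x Nx a ax c ac cx.
set f := (fun y => _) \o _ in df.
have fz0 : f (chart_map c x) != 0.
  rewrite /f /= chart_invK //; apply/eqP => f0; apply: bx; apply: (triv_inj ax).
  by rewrite f0 linear0.
have /continuous_nrm /(_ _ (nrm_gt0 fz0)) [d3 d30 d3P] := differentiable_continuous df.
have dt i : hol_ball (coordinate i \o chart_inv c) (chart_map c x) d1.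
  by move=> z /d1P[cz Nz zE]; rewrite -zE; exact: holfun_coordinate.
have [v vP] := dual_frame ac cx.
have m0 : 0 < Num.min (Num.min d1 d2) d3 by rewrite !lt_min d10 d20.
(* If [b x] were nonzero, so would be [b] at a nearby point of the zero set of [B] with [t_k]
   nonzero, where [t_k b = 0] forces [b = 0]. *)
have [z [zd ze zk]] := move_coordinate d10 dt vP k m0.
have zd1 : nrm (z - chart_map c x) < d1 by move: zd; rewrite !lt_min => /andP[/andP[]].
have zd2 : nrm (z - chart_map c x) < d2 by move: zd; rewrite !lt_min => /andP[/andP[]].
have zd3 : nrm (z - chart_map c x) < d3 by move: zd; rewrite !lt_min => /andP[].
have [cz Nz _] := d1P z zd1; have [_ az _] := d2P z zd2.
have tz : forall i, i \in B -> t (chart_inv c z) 0 i = 0.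
  move=> i iB; have ik : i != k by apply: contraTneq iB => ->.
  by have := ze i ik; rewrite /coordinate /= chart_invK // tx.
have [_ /(_ tz) /eqP] := tb _ Nz; rewrite scaler_eq0 => /orP[|/eqP bz].
  by move: zk; rewrite /coordinate /= chart_invK // tk0 => /negbTE ->.
have := d3P z zd3; have -> : f z = 0 by rewrite /f /= bz linear0.
by rewrite sub0r nrmN ltxx.
Qed.

Lemma vanishing_mul B x s k : vanishing B x s -> vanishing B x (fun y => t y 0 k *: s y).
Proof.
move=> [hs s0]; split; first by apply: (holo_atM (u := coordinate k)) => //; exact: holfun_coordinate.
by move=> /s0 ->; rewrite scaler0.
Qed.

Lemma vanishing_extend (B : {set 'I_r}) k x a b : vanishing B x a -> holo_at x b ->
  vanishing (k |: B) x (fun y => a y + t y 0 k *: b y).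
Proof.
move=> [ha a0] hb; split.
  apply: (germD germ_closed_holo ha); apply: (holo_atM (u := coordinate k)) => //; exact: holfun_coordinate.
move=> tx; rewrite tx ?setU11 // scale0r addr0 a0 // => i iB.
by rewrite tx // setU1r.
Qed.

Lemma coordinate_near_neq0 k x : t x 0 k != 0 -> nbhs x [set y | t y 0 k != 0].
Proof.
move=> tk; have [c ac cx] := cm_atlas_cover x.
have df := holfun_coordinate k ac cx.
have f0 : (coordinate k \o chart_inv c) (chart_map c x) != 0 by rewrite /coordinate /= chart_invK.
have /continuous_nrm /(_ _ (nrm_gt0 f0)) [d d0 dP] := differentiable_continuous df.
apply: filterS (chart_pull cx d0) => y [cy /dP].
rewrite /coordinate /= !chart_invK // => yd; apply: contraTneq yd => ->.
by rewrite sub0r nrmN ltxx.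
Qed.

(* Where t_k vanishes, a is s composed with a local retraction onto {t_k = 0}
   that preserves the other coordinates. *)
Lemma vanishing_split (B : {set 'I_r}) k x N s : k \notin B -> open N -> N x ->
  section_on (vanishing (k |: B)) N s -> exists N' a b,
  [/\ open N', N' x, section_on (vanishing B) N' a, section_on holo_at N' b &
    forall y, N' y -> s y = a y + t y 0 k *: b y].
Proof.
move=> kB oN Nx sJ; have [tk0|tk0] := eqVneq (t x 0 k) 0; last first.
  (* Away from the zeros of [t_k] one may divide: [a = 0] and [b = s / t_k]. *)
  pose N' := (N `&` [set y | t y 0 k != 0])°.
  have N'P : N' `<=` N `&` [set y | t y 0 k != 0] by exact: interior_subset.
  exists N', (fun=> 0), (fun y => (t y 0 k)^-1 *: s y); split.
  - exact: open_interior.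
  - by apply: filterI; [exact: open_nbhs_nbhs | exact: coordinate_near_neq0].
  - by move=> y _; exact: (germ0 (germ_closed_vanishing B)).
  - move=> y /N'P[Ny ty]; apply: (holo_atM (u := fun y => (coordinate k y)^-1)); last by have [] := sJ y Ny.
    by apply: holfun_atV => //; exact: holfun_coordinate.
  - by move=> y /N'P[Ny ty]; rewrite add0r scalerA divff ?scale1r.
have [c ac cx] := cm_atlas_cover x; have [al alx] := lb_dom_cover L x.
have oal : open (lb_dom al) by exact: lb_dom_open.
have oN2 : open (N `&` lb_dom al) by exact: openI.
have [d d0 dP] := chart_near cx (open_nbhs_nbhs (conj oN2 (conj Nx alx))).
set z0 := chart_map c x in dP.
pose f : Cn -> C^o := (fun y => lb_triv al y (s y)) \o chart_inv c.
have df : hol_ball f z0 d.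
  move=> z /dP[cz [Nz az] zE]; rewrite -zE.
  by have [hs _] := sJ _ Nz; exact: hs.
have dt i : hol_ball (coordinate i \o chart_inv c) z0 d.
  by move=> z /dP[cz Nz zE]; rewrite -zE; exact: holfun_coordinate.
have [v vP] := dual_frame ac cx.
have tk : (coordinate k \o chart_inv c) z0 = 0 by rewrite /coordinate /= chart_invK.
have [e [rho [b [/andP[e0 ed] drho db rhoP]]]] := local_retraction d0 dt vP tk df.
pose N' := ([set y | chart_dom c y /\ nrm (chart_map c y - z0) < e])°.
have N'P : N' `<=` [set y | chart_dom c y /\ nrm (chart_map c y - z0) < e] by exact: interior_subset.
have N'N y : N' y -> N y /\ lb_dom al y.
  move=> /N'P[cy ye]; have [_ Ny _] := dP _ (lt_le_trans ye ed).
  by rewrite chart_invK in Ny.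
have dfr y : N' y -> differentiable (f \o rho) (chart_map c y).
  move=> /N'P[cy ye]; have [r1 _ _ _] := rhoP _ ye.
  exact: (differentiable_comp_at erefl (drho _ ye) (df _ r1)).
have pull (g : Cn -> C^o) y : N' y -> differentiable g (chart_map c y) -> holfun_at (g \o chart_map c) y.
  move=> N'y dg; have [cy ye] := N'P y N'y.
  apply: (holfun_at_chart ac cy).
  apply: differentiable_near_eq dg; apply/nbhs_nrm.
  have od : open (chart_dom c) by exact: chart_dom_open.
  have [q q0 qP] := chart_near cy (open_nbhs_nbhs (conj od cy)).
  by exists q => // z /qP[_ _ zE] /=; rewrite zE.
exists N', (untriv al ((f \o rho) \o chart_map c)), (untriv al (b \o chart_map c)); split.
- exact: open_interior.
- exact: chart_pull.
- move=> y N'y; have [Ny ay] := N'N y N'y; have [cy ye] := N'P y N'y; split.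
    by apply: holo_at_untriv => //; apply: pull => //; exact: dfr.
  move=> ty; apply: (triv_inj ay); rewrite untrivK // linear0 /=.
  have [r1 rk ri _] := rhoP _ ye; have [cr [Nr ar] rE] := dP _ r1.
  have [_ s0] := sJ _ Nr; rewrite /f /= s0 ?linear0 // => i.
  rewrite in_setU1 => /predU1P[->|iB]; first exact: rk.
  have ik : i != k by apply: contraTneq iB => ->.
  by have := ri i ik; rewrite /coordinate /= chart_invK // => ->; exact: ty.
- move=> y N'y; have [Ny ay] := N'N y N'y; have [cy ye] := N'P y N'y.
  by apply: holo_at_untriv => //; apply: pull => //; exact: db.
- move=> y N'y; have [Ny ay] := N'N y N'y; have [cy ye] := N'P y N'y.
  apply: (triv_inj ay); rewrite linearD linearZ !untrivK //=.
  have [_ _ _] := rhoP _ ye.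
  by rewrite /f /coordinate /= chart_invK.
Qed.

(** The two claims go through one induction on [#|A|]: splitting sections over [U] for [A] uses
    acyclicity for [A] without [k]. *)
Lemma vanishing_generated (U : set X) (A : {set 'I_r}) : open U -> acyclic holo_at U ->
  acyclic (vanishing A) U /\
  forall s, section_on (vanishing A) U s -> exists s_ : 'I_r -> lsection L,
    (forall i, i \in A -> section_on holo_at U (s_ i)) /\
    (forall x, U x -> s x = \sum_(i in A) t x 0 i *: s_ i x).
Proof.
move=> oU acO; have [m] := ubnP #|A|; elim: m A => // m IH A Am.
(* For the empty set the vanishing condition applies at every point, so the sheaf is 0. *)
have [->|[k kA]] := set_0Vmem A.
  split.
    move=> q V c cK dc; exists V, id, (fun _ _ => 0); split => //.
      by move=> j x.
      by move=> i x _; exact: (germ0 (germ_closed_vanishing _)).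
    move=> i x ix; have [_ c0] := cK i x ix; rewrite /cochain_pullback c0.
      by rewrite /cech_diff big1 // => l _; rewrite scaler0.
    by move=> j; rewrite inE.
  move=> s sK; exists (fun _ _ => 0); split => [i|x Ux]; first by rewrite inE.
  have [_ s0] := sK x Ux; rewrite s0 ?big_set0 // => j; by rewrite inE.
pose B := A :\ k.
have AE : A = k |: B by rewrite finset.setD1K.
have kB : k \notin B by rewrite finset.setD11.
have [|acB genB] := IH B.
  by move: Am; rewrite AE cardsU1 kB add1n ltnS.
rewrite AE; have HK := germ_closed_vanishing B; have HO := germ_closed_holo.
have reg := vanishing_regular kB; have spl := vanishing_split kB.
have KO x s : vanishing B x s -> holo_at x s by case.
have KM x s : vanishing B x s -> vanishing B x (fun y => t y 0 k *: s y) by exact: vanishing_mul.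
split.
  apply: (acyclic_extension (t := fun y => t y 0 k) manifold_regular HK HO KO KM _ _ _ acB acO).
  - by move=> x a b; exact: vanishing_extend.
  - by move=> x N s oN Nx; exact: spl.
  - by move=> x N b oN Nx; exact: reg.
move=> s sJ.
have [||a [b [aK bO sE]]] := section_extension (t := fun y => t y 0 k) manifold_regular HK HO KO KM _ _
    oU acB sJ.
- by move=> x N s' oN Nx; exact: spl.
- by move=> x N b oN Nx; exact: reg.
have [a_ [a_O aE]] := genB a aK.
exists (fun i => if i == k then b else a_ i); split => [i|x Ux].
  by rewrite in_setU1; case: eqP => //= _ iB; exact: a_O.
rewrite big_setU1 //= eqxx sE // aE // addrC; congr (_ + _).
apply: eq_bigr => i iB; case: eqP => // ik.
by move: kB; rewrite -ik iB.
Qed.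

End Submersion.
End Bundle.
End Manifold.

Lemma cech_acyclicE (R : realType) (n : nat) (X : complexManifold R n) (L : lineBundle X) (U : set X) :
  cech_acyclic L U -> acyclic (@holo_at R n X L) U.
Proof.
move=> hU q V c cO dc.
have [|T [rho [sigma [r1 r2 [b bO cE]]]]] := hU q V c.
  by split => // i; apply/holomorphic_sectionP; exact: cO.
exists T, rho, b; split => //.
  by move=> i; apply/holomorphic_sectionP; exact: bO.
by move=> i x ix; rewrite -(cE i x ix) /cochainB /cochain_pullback /cochain0 subr0.
Qed.

Theorem theoremA1 (R : realType) (r n : nat) (X : complexManifold R n)
    (t : X -> 'rV[Cplx R]_r) (ht : holomorphic_submersion t)
    (L : lineBundle X) (A : {set 'I_r})
    (U : set X) (oU : open U)
    (hU : cech_acyclic L U)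
    (s : lsection L) (hs : holomorphic_section U s)
    (hs0 : forall x : X, U x -> (forall i, i \in A -> t x 0 i = 0) -> s x = 0) :
  exists s_ : 'I_r -> lsection L,
    (forall i, i \in A -> holomorphic_section U (s_ i)) /\
    (forall x : X, U x -> s x = \sum_(i in A) t x 0 i *: s_ i x).
Proof.
have [_ gen] := vanishing_generated ht A oU (cech_acyclicE hU).
have [|s_ [s_O sE]] := gen s.
  move=> x Ux; split; last exact: hs0.
  by move/holomorphic_sectionP: hs; apply.
exists s_; split => // i iA.
by apply/holomorphic_sectionP; exact: s_O.
Qed.
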